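(* Let $H$ be a real Hilbert space with scalar product $\langle\cdot,\cdot\rangle$ and norm $\|\cdot\|$, and let $A$ be a self-adjoint linear operator on $H$ with dense domain $D(A)$ such that, for some constant $C>0$, $\langle Ax,x\rangle\ge C\|x\|^2$ for all $x\in D(A)$. Let $k:[0,\infty)\to[0,\infty)$ be a locally absolutely continuous function with $k(0)>0$, $\int_0^\infty k(t)\,dt=1$, and, for some constant $\eta>0$, $k'(t)\le-\eta\,k(t)$ for a.e. $t\ge0$. Let $u$ be a weak solution of $$u''(t)+Au(t)-\int_0^t k(t-s)Au(s)\,ds=0,\qquad t\in(0,\infty),$$ and let $$E(t)=\frac12\|u'(t)\|^2+\frac12\Big(1-\int_0^t k(s)\,ds\Big)\|A^{1/2}u(t)\|^2+\frac12\int_0^t k(t-s)\,\|A^{1/2}u(s)-A^{1/2}u(t)\|^2\,ds,\qquad t\ge0,$$ be its energy. Then $$E(t)\le E(0)\,e^{1-\alpha t}\qquad\forall t\ge0,$$ where $$\alpha=\frac{1}{2\Big(\frac{k(0)+2}{C}+1+\frac{3}{\eta}\Big)}.$$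
   Context: $A^{1/2}$ denotes the positive self-adjoint square root of $A$, with domain $D(A^{1/2})$ endowed with the norm $\|A^{1/2}x\|$. A weak solution of the equation is a function $u\in C([0,\infty);D(A^{1/2}))\cap C^1([0,\infty);H)$ such that for every $v\in D(A^{1/2})$ the function $t\mapsto\langle u'(t),v\rangle$ belongs to $C^1([0,\infty))$ and $$\frac{d}{dt}\langle u'(t),v\rangle+\langle A^{1/2}u(t),A^{1/2}v\rangle-\int_0^t k(t-s)\langle A^{1/2}u(s),A^{1/2}v\rangle\,ds=0\qquad\forall t\ge0.$$ *)

(* Defs.v *)
From HB Require Import structures.
From mathcomp Require Import all_boot all_order all_algebra.
From mathcomp Require Import all_classical all_reals all_analysis.
Import Order.TTheory GRing.Theory Num.Theory.
Import numFieldNormedType.Exports.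

Set Implicit Arguments.
Unset Strict Implicit.
Unset Printing Implicit Defensive.

Local Open Scope classical_set_scope.
Local Open Scope ring_scope.

(* Unbounded linear operators; only the values of [op_fun] on [op_dom] are
   meaningful. *)
Record linear_operator (R : realType) (H : normedModType R) := LinearOperator {
  op_dom : set H ;
  op_fun :> H -> H ;
  op_dom0 : op_dom 0 ;
  op_domP : forall (a : R) x y,
    op_dom x -> op_dom y -> op_dom (a *: x + y) ;
  op_linear : forall (a : R) x y, op_dom x -> op_dom y ->
    op_fun (a *: x + y) = a *: op_fun x + op_fun y }.

Section Hilbert.
Context {R : realType} {H : completeNormedModType R}.
Variable dot : {dot H for @idfun R}.

Definition hilbert_norm := forall x : H, `|x| ^+ 2 = dot x x.

(* A and its adjoint, which is single-valued since dom A is dense, have the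
   same graph. *)
Definition self_adjoint (A : linear_operator H) :=
  dense (op_dom A) /\
  forall y z, (op_dom A y /\ A y = z) <->
              (forall x, op_dom A x -> dot (A x) y = dot x z).

Definition positive_operator (A : linear_operator H) :=
  forall x, op_dom A x -> 0 <= dot (A x) x.

(* Equality of the unbounded operators A and B o B, domains included. *)
Definition is_square_of (A B : linear_operator H) :=
  (forall x, op_dom A x <-> (op_dom B x /\ op_dom B (B x))) /\
  (forall x, op_dom A x -> A x = B (B x)).

(* B = A^{1/2}. *)
Definition is_sqrt_operator (A B : linear_operator H) :=
  [/\ self_adjoint B, positive_operator B & is_square_of A B].

End Hilbert.

Section HalfLine.
Context {R : realType}.

(* Derivatives of functions on [0, +oo[, one-sided at 0; values at negative
   arguments are never used. *)
Definition quotient_halfline {W : normedModType R} (f : R -> W) (t : R) :=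
  (fun s => (s - t)^-1 *: (f s - f t)) @ within [set s | 0 <= s] t^'.

Definition derivable_halfline {W : normedModType R} (f : R -> W) (t : R) :=
  cvg (quotient_halfline f t).

Definition derive_halfline {W : normedModType R} (f : R -> W) (t : R) : W :=
  lim (quotient_halfline f t).

Definition C1_halfline {W : normedModType R} (f : R -> W) :=
  (forall t, 0 <= t -> derivable_halfline f t) /\
  {within `[0, +oo[, continuous (derive_halfline f)}.

Definition absolutely_continuous_on (a b : R) (f : R -> R) :=
  forall e : R, 0 < e -> exists2 d : R, 0 < d &
    forall (n : nat) (p q : 'I_n -> R),
      (forall i, a <= p i /\ p i <= q i /\ q i <= b) ->
      trivIset setT (fun i => `]p i, q i[%classic) ->
      \sum_(i < n) (q i - p i) < d ->
      \sum_(i < n) `|f (q i) - f (p i)| < e.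

Definition locally_absolutely_continuous (f : R -> R) :=
  forall T : R, 0 < T -> absolutely_continuous_on 0 T f.

End HalfLine.

Section Evolution.
Context {R : realType} {H : completeNormedModType R}.
Variables (dot : {dot H for @idfun R}) (k : R -> R).
Notation mu := (@lebesgue_measure R).

(* B stands for A^{1/2}. *)
Definition continuous_in_dom (B : linear_operator H) (u : R -> H) :=
  (forall t, 0 <= t -> op_dom B (u t)) /\
  (forall t, 0 <= t ->
    `|B (u s - u t)| @[s --> within [set s | 0 <= s] (nbhs t)] --> (0 : R)).

Definition weak_solution (B : linear_operator H) (u : R -> H) :=
  [/\ continuous_in_dom B u,
      C1_halfline u &
      forall v, op_dom B v ->
        let w := fun t => dot (derive_halfline u t) v : R^o in
        C1_halfline w /\
        forall t, 0 <= t ->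
          derive_halfline w t + dot (B (u t)) (B v)
            - \int[mu]_(s in `[0, t]) (k (t - s) * dot (B (u s)) (B v)) = 0].

Definition energy (B : linear_operator H) (u : R -> H) (t : R) : R :=
  2^-1 * `|derive_halfline u t| ^+ 2
  + 2^-1 * (1 - \int[mu]_(s in `[0, t]) k s) * `|B (u t)| ^+ 2
  + 2^-1 * \int[mu]_(s in `[0, t]) (k (t - s) * `|B (u s) - B (u t)| ^+ 2).

End Evolution.

(* Main.v *)
(* Idea.  Write [B] for the square root of [A], [p = k * u - u] (convolution in
   time) and [q' = p' + u'].  The equation reads [u'' = A p], and
     E' = - D,  D = 1/2 k |B u|^2 + 1/2 int_0^t (- k')(t - s) |B u(s) - B u(t)|^2 ds,
     <u', p>' = |B p|^2 - |u'|^2 + <u', q'>.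
   As [k] has mass 1 and [- k' >= eta k], Cauchy-Schwarz gives
     |B p|^2 <= (1 - int_0^t k) |B u|^2 + int_0^t k(t - s) |B u(s) - B u(t)|^2 ds <= 2 D / eta
   and [<u', q'> <= 1/2 |u'|^2 + k(0) / C D].  With [T = (k(0) + 2) / C + 1 + 3 / eta]
   and [eps = 2 / (3 T)], the functional [L = E + eps <u', p>] lies between [2/3 E]
   and [4/3 E] and satisfies [L' <= - eps E <= - L / (2 T)]; hence
   [E(t) <= 2 E(0) exp (- t / (2 T))], and [2 <= e].

   A weak solution is not regular enough for this computation, so it is carried
   out on [J u], where [J = (n (B + n)^-1)^2] commutes with [B] and maps [H] into
   the domain of [A], and [n] is sent to infinity.  The derivative of a convolution
   with [k] is always put on the other factor, so that [k'] only enters through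
   the monotonicity of absolutely continuous functions with derivative [<= 0]. *)
Require Import Defs.
From HB Require Import structures.
From mathcomp Require Import all_boot all_order all_algebra.
From mathcomp Require Import all_classical all_reals all_analysis.
From mathcomp Require Import measurable_realfun.
From mathcomp Require Import ring lra.
Import Order.TTheory GRing.Theory Num.Theory.
Import numFieldNormedType.Exports.

Local Open Scope classical_set_scope.
Local Open Scope ring_scope.

Set Implicit Arguments.
Unset Strict Implicit.
Unset Printing Implicit Defensive.

(** * Real Hilbert spaces *)

(** The summands of [T] have two origins. The sign of [L'] costs [3 / eta + k(0) / C]: after adding
    half of [|u'|^2] and of the memory norm, the bounds on [|B p|^2] and [<u', q'>] leave at most
    that multiple of [D]. Keeping [eps <u', p>] below a third of [E] costs [1 + 2 / C]. The choice
    [eps T = 2 / 3] serves both. The factor [k(0) / C] appears because, formally, [q' = k(t) u(t) +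
    int_0^t (- k')(t - s) (u(t) - u(s)) ds], an average of total mass [k(0)], compared with [D] by
    Cauchy-Schwarz and coercivity. As [k'] exists only almost everywhere, this is replaced by a
    nonnegative test function fed to the same monotonicity lemma that gives [eta |B p|^2 <= 2 D].
    Two further obstacles shape the file. The second derivative of [u] exists only against test
    vectors, so curves carry a weak derivative with a local bound, which suffices for a product
    rule. Convolutions with values in [H] are not integrated: they are Riesz representatives of
    scalar convolutions. *)

Section InnerProduct.
Context {R : realType} {H : completeNormedModType R}.
Variable dot : {dot H for @idfun R}.

Lemma dotC x y : dot x y = dot y x.
Proof. by rewrite hermC /= expr0 mul1r. Qed.

Lemma dotDl x y z : dot (x + y) z = dot x z + dot y z.
Proof. exact: linearDl. Qed.

Lemma dotBl x y z : dot (x - y) z = dot x z - dot y z.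
Proof. exact: linearBl. Qed.

Lemma dotZl a x z : dot (a *: x) z = a * dot x z.
Proof. exact: linearZl_LR. Qed.

Lemma dotDr x y z : dot z (x + y) = dot z x + dot z y.
Proof. by rewrite dotC dotDl !(dotC z). Qed.

Lemma dotBr x y z : dot z (x - y) = dot z x - dot z y.
Proof. by rewrite dotC dotBl !(dotC z). Qed.

Lemma dotZr a x z : dot z (a *: x) = a * dot z x.
Proof. by rewrite dotC dotZl (dotC z). Qed.

Lemma dot0l z : dot 0 z = 0.
Proof. by rewrite -(scale0r 0) dotZl mul0r. Qed.

Lemma dotNl x z : dot (- x) z = - dot x z.
Proof. by rewrite -scaleN1r dotZl mulN1r. Qed.

Lemma dotNr x z : dot z (- x) = - dot z x.
Proof. by rewrite dotC dotNl dotC. Qed.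

Lemma dot0r z : dot z 0 = 0.
Proof. by rewrite dotC dot0l. Qed.

Hypothesis hdot : hilbert_norm dot.

Lemma dot_ge0 x : 0 <= dot x x.
Proof. by rewrite -hdot sqr_ge0. Qed.

Lemma normB2 x y : `|x - y| ^+ 2 = `|x| ^+ 2 - 2 * dot x y + `|y| ^+ 2.
Proof. by rewrite !hdot !(dotBl, dotBr) (dotC y x); ring. Qed.

Lemma dot_le_half x y : dot x y <= 2^-1 * (`|x| ^+ 2 + `|y| ^+ 2).
Proof.
have := sqr_ge0 `|x - y|; rewrite normB2; lra.
Qed.

(** Cauchy-Schwarz: once [x] is rescaled to the norm of [y], the bound [dot_le_half] is already
    sharp. *)
Lemma dot_le_norm x y : `|dot x y| <= `|x| * `|y|.
Proof.
wlog: x y / 0 < `|x| /\ 0 < `|y|.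
  move=> hw; case: (eqVneq x 0) => [->|x0]; first by rewrite dot0l !normr0 mul0r.
  case: (eqVneq y 0) => [->|y0]; first by rewrite dot0r !normr0 mulr0.
  by apply: hw; rewrite !normr_gt0.
move=> [x0 y0].
have key z : `|z| = `|x| -> dot z y <= `|x| * `|y|.
  move=> zx.
  have := dot_le_half ((`|y| / `|x|) *: z) y.
  rewrite dotZl normrZ zx ger0_norm; last by rewrite divr_ge0.
  rewrite divfK ?gt_eqF// => h.
  rewrite -(ler_pM2l (_ : 0 < `|y| / `|x|)); last by rewrite divr_gt0.
  apply: le_trans h _; rewrite le_eqVlt; apply/orP; left; apply/eqP.
  by field; rewrite gt_eqF.
rewrite ler_norml -lerN2 opprK -dotNl !key ?normrN//.
Qed.

Lemma dot_eq (x y : H) : (forall v, dot x v = dot y v) -> x = y.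
Proof.
move=> h; apply/eqP; by rewrite -subr_eq0 -normr_eq0 -sqrf_eq0 hdot dotBl h subrr.
Qed.

(** Taking [v = x] suffices. This turns weak estimates into norm estimates for vectors known only
    through their scalar products. *)
Lemma norm_le_dot (x : H) (M : R) : 0 <= M ->
  (forall v, dot x v <= M * `|v|) -> `|x| <= M.
Proof.
move=> M0 /(_ x); rewrite -hdot.
have [->|x0] := eqVneq x 0; first by rewrite normr0.
by rewrite expr2 ler_pM2r // normr_gt0.
Qed.

Lemma dot_cvg {T} {F : set_system T} {FF : Filter F} (a : T -> H) l v :
  a @ F --> l -> dot (a t) v @[t --> F] --> dot l v.
Proof.
move=> al; apply/cvgrPdist_lt => e e0.
have e1 : 0 < e / (`|v| + 1) by rewrite divr_gt0// ltr_wpDl.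
move/cvgrPdist_lt: al => /(_ _ e1); apply: filterS => t ht.
rewrite -dotBl; apply: le_lt_trans (dot_le_norm _ _) _.
have v1 : 0 < `|v| + 1 by rewrite ltr_wpDl.
move: ht; rewrite ltr_pdivlMr//; apply: le_lt_trans.
by rewrite ler_wpM2l// lerDl.
Qed.

(** A minimizing sequence for the distance is Cauchy by the parallelogram identity, and a first
    variation at the minimizer gives orthogonality. *)
Lemma projection_theorem (M : set H) (x : H) : closed M -> M 0 ->
  (forall a y z, M y -> M z -> M (a *: y + z)) ->
  exists2 m, M m & forall y, M y -> dot (x - m) y = 0.
Proof.
move=> Mc M0 Ml.
pose S := [set `|x - y| ^+ 2 | y in M].
have S0 : has_inf S.
  split; first by exists (`|x - 0| ^+ 2); exists 0.
  by exists 0 => _ [y _ <-]; exact: sqr_ge0.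
have dS y : M y -> inf S <= `|x - y| ^+ 2.
  by move=> My; apply: ge_inf; [exact: S0.2|exists y].
have /choice[y Hy] : forall n : nat, exists y, M y /\ `|x - y| ^+ 2 < inf S + n.+1%:R^-1.
  move=> n; have /(inf_adherent (eps := n.+1%:R^-1)) : has_inf S by [].
  by rewrite invr_gt0 ltr0n => /(_ isT)[_ [z Mz <-] h]; exists z.
(* The midpoint of [y n] and [y m] lies in [M], so its squared distance to [x] is at least
   [inf S]. *)
have par n m : `|y n - y m| ^+ 2 <= 2 * (n.+1%:R^-1 + m.+1%:R^-1).
  have [[Myn hn] [Mym hm]] := (Hy n, Hy m).
  have := dS (2^-1 *: y n + 2^-1 *: y m); rewrite -[X in M (_ + X)]addr0.
  move=> /(_ (Ml _ _ _ Myn (Ml _ _ _ Mym M0))).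
  move: hn hm; rewrite !hdot.
  rewrite !(dotBl, dotBr, dotDl, dotDr, dotZl, dotZr) (dotC (y n) x) (dotC (y m) x) (dotC (y m)
    (y n)).
  move: (n.+1%:R^-1) (m.+1%:R^-1) (inf S) (dot x x) (dot x (y n)) (dot x (y m)) (dot (y n) (y
    n)) (dot (y m) (y m)) (dot (y n) (y m)) => *; lra.
have cy : cauchy (y @ \oo).
  apply: cauchy_exP => e e0.
  have : \forall n \near \oo, n.+1%:R^-1 < e ^+ 2 / 4 :> R.
    have := @cvg_harmonic R => /cvgrPdist_lt/(_ (e ^+ 2 / 4)).
    rewrite divr_gt0 ?exprn_gt0// => /(_ isT); apply: filterS => n.
    by rewrite sub0r normrN ger0_norm ?invr_ge0.
  move=> [N _ hN]; exists (y N); exists N => //= n /= Nn.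
  rewrite /= -ball_normE /=.
  rewrite -(ltr_pXn2r (n := 2))//= ?nnegrE ?(ltW e0)//.
  apply: le_lt_trans (par _ _) _.
  have h1 : n.+1%:R^-1 < e ^+ 2 / 4 := hN _ Nn.
  have h2 : N.+1%:R^-1 < e ^+ 2 / 4 := hN _ (leqnn N).
  by move: (n.+1%:R^-1) (N.+1%:R^-1) h1 h2 => a b h1 h2; lra.
have /cvg_ex[m ym] : cvg (y @ \oo) by exact: cauchy_cvg.
have Mm : M m.
  by apply: (@closed_cvg _ _ \oo _ y M Mc _ m ym); apply: nearW => n; have [] := Hy n.
have dm : `|x - m| ^+ 2 <= inf S.
  have hc : `|x - y n| ^+ 2 @[n --> \oo] --> `|x - m| ^+ 2.
    have hn : `|x - y n| @[n --> \oo] --> `|x - m|.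
      by apply: cvg_norm; apply: cvgB => //; exact: cvg_cst.
    by rewrite expr2; under eq_fun do rewrite expr2; exact: cvgM.
  have hd : inf S + n.+1%:R^-1 @[n --> \oo] --> inf S.
    rewrite -[X in _ --> X]addr0; apply: cvgD; first exact: cvg_cst.
    exact: cvg_harmonic.
  apply: (ler_cvg_to hc hd).
  by apply: nearW => n; apply/ltW; have [] := Hy n.
exists m => // z Mz; apply/eqP; apply: contraT => nz.
have zz : 0 < dot z z.
  rewrite lt_neqAle dot_ge0 andbT eq_sym -hdot sqrf_eq0 normr_eq0.
  by apply: contra nz => /eqP->; rewrite dot0r.
(* The best competitor on the line [m + R z] lowers the squared distance by [a ^+ 2 / dot z z],
   which minimality forbids unless [a = 0]. *)
have := le_trans dm (dS ((dot (x - m) z / dot z z) *: z + m) (Ml _ _ _ Mz Mm)).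
rewrite (addrC _ m) opprD addrA [X in _ <= X]normB2 dotZr normrZ exprMn real_normK ?num_real//.
rewrite [`|z| ^+ 2]hdot.
set a := dot _ _.
have -> : `|x - m| ^+ 2 - 2 * (a / dot z z * a) + (a / dot z z) ^+ 2 * dot z z =
  `|x - m| ^+ 2 - a ^+ 2 / dot z z.
  by field; rewrite gt_eqF.
rewrite lerBrDl gerDr leNgt divr_gt0// lt_neqAle sqr_ge0 andbT eq_sym.
by rewrite sqrf_eq0.
Qed.

(** If [l x != 0], the component [n] of [x] orthogonal to the closed kernel of [l] represents [l] up
    to a scalar, because [y - (l y / l x) n] lies in the kernel for every [y]. *)
Lemma riesz_representation (l : H -> R) (C : R) :
  (forall a y z, l (a *: y + z) = a * l y + l z) ->
  (forall x, `|l x| <= C * `|x|) -> exists z, forall x, l x = dot z x.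
Proof.
move=> ll lC.
have [l0|] := pselect (forall x, l x = 0).
  by exists 0 => x; rewrite l0 dot0l.
move=> /existsNP[x /eqP lx].
have lc : closed [set y | l y = 0].
  have -> : [set y | l y = 0] = l @^-1` [set 0] by [].
  apply: preimage_closed; last exact: closed_eq.
  move=> y _; apply/cvgrPdist_lt => e e0.
  have C1 : 0 < `|C| + 1 by rewrite ltr_wpDl.
  have := @cvg_id _ (nbhs y) => /cvgrPdist_lt/(_ (e / (`|C| + 1))).
  rewrite divr_gt0// => /(_ isT); apply: filterS => z.
  rewrite ltr_pdivlMr// => h.
  have -> : l y - l z = l (y - z).
    by rewrite addrC -mulN1r -ll scaleN1r addrC.
  apply: le_lt_trans (lC _) _; apply: le_lt_trans h.
  by rewrite mulrC ler_wpM2l//; have := ler_norm C; lra.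
have l0 : l 0 = 0.
  by have := ll 1 0 0; rewrite scale1r addr0 mul1r => h; lra.
have [|m /= m0 mz] := @projection_theorem [set y | l y = 0] x lc l0.
  by move=> a y z /= hy hz; rewrite ll hy hz mulr0 addr0.
have lxm : l (x - m) = l x by rewrite addrC -scaleN1r ll m0 mulr0 add0r.
pose n := x - m.
have nn : dot n n != 0.
  rewrite -hdot sqrf_eq0 normr_eq0; apply: contra lx => /eqP n0.
  by rewrite -lxm -/n n0 l0.
exists ((l x / dot n n) *: n) => y; rewrite dotZl.
have := mz (- (l y / l x) *: n + y).
rewrite /= ll lxm mulNr divfK// addNr => /(_ erefl).
rewrite dotDr dotZr -/n => /eqP; rewrite addrC mulNr subr_eq0 => /eqP ->.
by field; rewrite nn lx.
Qed.

End InnerProduct.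

(** * Absolutely continuous functions *)

Section AbsolutelyContinuous.
Context {R : realType}.
Notation mu := (@lebesgue_measure R).

(** Outer regularity encloses the null set [N] in an open [U] of measure below the [d] attached to
    [e]; disjoint intervals inside [U] then have total length below [d]. *)
Lemma absolutely_continuous_small_increments (f : R -> R) (a b e : R) (N : set R) :
  absolutely_continuous_on a b f -> 0 < e -> measurable N -> mu N = 0%E ->
  exists U, [/\ open U, N `<=` U &
    forall (n : nat) (p q : nat -> R),
      (forall i, (i < n)%N -> [/\ a <= p i, p i <= q i, q i <= b & `]p i, q i[%classic `<=` U]) ->
      (forall i j, (i < j < n)%N -> q i <= p j) ->
      \sum_(i < n) (f (q i) - f (p i)) < e].
Proof.
move=> fac e0 mN N0; have [d d0 Hd] := fac _ e0.
have [|U [oU NU Ud]] := lebesgue_regularity_outer (eps := d) mN _ d0.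
  by rewrite [X in (X < _)%E]N0 ltry.
have mU : measurable U by exact: open_measurable.
have Ulte : (mu U < d%:E)%E.
  apply: le_lt_trans Ud.
  have {1}-> : U = (U `\` N) `|` N by rewrite setDKU.
  apply: le_trans (measureU2 _ _ _) _ => //; first exact: measurableD.
  by rewrite [X in (_ + X)%E]N0 adde0.
exists U; split=> // n p q Hpq Hord.
have triv : trivIset setT (fun i : 'I_n => `]p i, q i[%classic).
  have dis (i j : 'I_n) : (i < j)%N -> `]p i, q i[%classic `&` `]p j, q j[%classic = set0.
    move=> ij; rewrite -subset0 => x [] /=; rewrite !in_itv /= => /andP[_ h1] /andP[h2 _].
    have := Hord i j; rewrite ij ltn_ord => /(_ isT); move: h1 h2; lra.
  apply/trivIsetP => i j _ _ ij; have [//|ji|/val_inj e1] := ltngtP i j.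
  - exact: dis.
  - by rewrite setIC; exact: dis.
  - by rewrite e1 eqxx in ij.
have mi (i : 'I_n) : measurable `]p i, q i[%classic by exact: measurable_itv.
have lens : \sum_(i < n) (q i - p i) < d.
  rewrite -lte_fin; apply: le_lt_trans Ulte.
  rewrite -sumEFin.
  have -> : (\sum_(i < n) (q i - p i)%:E)%E = mu (\big[setU/set0]_(i < n) `]p i, q i[%classic).
    rewrite measure_bigsetU_ord//; apply: eq_bigr => i _.
    have := lebesgue_measure_itv `]p i, q i[; rewrite /= lte_fin => h.
    rewrite [RHS]h.
    have [_ pq _ _] := Hpq i (ltn_ord i).
    case: ltP => // qp; have -> : q i - p i = 0; first by lra.
    by [].
  apply: le_measure; rewrite ?inE//; first exact: bigsetU_measurable.
  by move=> x; rewrite -(bigcup_mkord n (fun i => `]p i, q i[%classic)) => -[i /= ni];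
    have [_ _ _] := Hpq i ni; apply.
apply: le_lt_trans (Hd n (fun i => p i) (fun i => q i) _ triv lens).
  by apply: ler_sum => i _; exact: ler_norm.
by move=> i; have [] := Hpq i (ltn_ord i).
Qed.

(** Around a good point the slopes of [f] are at most [e]; around a point of the null set, intervals
    stay inside the small open set [U]. Exhausting [[a, b]] by finitely many intervals of these two
    kinds bounds the increment by [e * (b - a) + e]. *)
Lemma absolutely_continuous_nonincreasing (f : R -> R) (a b : R) : a <= b ->
  absolutely_continuous_on a b f ->
  {ae mu, forall x, a < x < b -> derivable f x 1 /\ derive1 f x <= 0} ->
  f b <= f a.
Proof.
move=> ab fac [N0 [mN0 N00 HN0]].
suff main e : 0 < e -> f b - f a <= e * (b - a) + e.
  rewrite -subr_le0; apply/ler_addgt0Pl => e e0; rewrite addr0.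
  apply: le_trans (main (e / (b - a + 1)) _) _; first by rewrite divr_gt0//; lra.
  by rewrite le_eqVlt; apply/orP; left; apply/eqP; field; lra.
move=> e0.
(* The endpoints are treated as bad points, since differentiability is given on the open
   interval. *)
pose N := N0 `|` [set a] `|` [set b].
have mN : measurable N by do !apply: measurableU => //; exact: measurable_set1.
have muN : mu N = 0%E.
  rewrite /N !measureU0 //; try exact: lebesgue_measure_set1.
  by do !apply: measurableU => //; exact: measurable_set1.
have [U [oU NU HU]] := absolutely_continuous_small_increments fac e0 mN muN.
(* Only intervals containing [c] are considered: the slope estimates to the left and to the right of
   [c] then add up. *)
have local c : a <= c <= b -> exists2 r, 0 < r & forall p q, a <= p -> p <= c -> c <= q -> q <= b ->
    c - r < p -> q < c + r -> f q - f p <= e * (q - p) \/ `]p, q[%classic `<=` U.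
  move=> /andP[ac cb]; have [Nc|Nc] := pselect (N c).
    have /nbhs_ballP[r /= r0 rU] : nbhs c U by apply: open_nbhs_nbhs; split => //; exact: NU.
    exists r => // p q _ _ _ _ h1 h2; right => x /=; rewrite in_itv /= => /andP[h3 h4].
    by apply: rU; rewrite -ball_normE /= ltr_norml; lra.
  have {}ac : a < c by rewrite lt_neqAle ac andbT; apply/eqP => e1; apply: Nc; left; right.
  have {}cb : c < b by rewrite lt_neqAle cb andbT; apply/eqP => e1; apply: Nc; right.
  have [dfc dc] : derivable f c 1 /\ derive1 f c <= 0.
    have : ~ N0 c by move=> h; apply: Nc; left; left.
    by move=> /(contra_not (@HN0 c))/contrapT; apply; rewrite ac cb.
  move: dfc => /cvg_ex[l]/= hl.
  have ld : derive1 f c = l by rewrite derive1E; exact: cvg_lim hl.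
  rewrite ld in dc.
  move/cvgrPdist_lt: hl => /(_ _ e0) /nbhs_ballP[r /= r0 hr].
  have est h : h != 0 -> `|h| < r -> `|l - h^-1 * (f (h + c) - f c)| < e.
    move=> h0 hlt; have := hr h; rewrite -ball_normE /= sub0r normrN => /(_ hlt h0).
    by rewrite [h *: 1]mulr1.
  exists r => // p q ap pc cq qb cr qr; left.
  have right_est : f q - f c <= e * (q - c).
    have [->|qc] := eqVneq q c; first by rewrite !subrr mulr0.
    have qc0 : 0 < q - c by move: qc cq; rewrite lt_neqAle eq_sym subr_ge0; lra.
    have := est (q - c); rewrite subrK gt_eqF// gtr0_norm// => /(_ isT).
    have h1 : q - c < r by lra.
    move=> /(_ h1); rewrite ltr_norml => /andP[h2 _].
    rewrite mulrC -ler_pdivrMl// ; move: h2 dc; set z := (_^-1 * _); lra.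
  have left_est : f c - f p <= e * (c - p).
    have [->|pc'] := eqVneq p c; first by rewrite !subrr mulr0.
    have pc0 : 0 < c - p by rewrite subr_gt0 lt_neqAle pc'.
    have := est (p - c); rewrite subrK lt_eqF; last by lra.
    rewrite ltr0_norm; last by lra.
    have h1 : - (p - c) < r by lra.
    move=> /(_ isT h1); rewrite ltr_norml => /andP[h2 _].
    rewrite mulrC -ler_pdivrMl//; move: h2 dc.
    have -> : (p - c)^-1 * (f p - f c) = (c - p)^-1 * (f c - f p).
      by field; apply/andP; split; lra.
    set z := (_^-1 * _); lra.
  by move: left_est right_est; lra.
(* [P x]: the increment of [f] over [a, x] is small up to finitely many disjoint
   intervals inside [U]; [P] propagates from [a] to [b] by a supremum argument. *)
pose P x := exists n (p q : nat -> R), [/\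
  forall i, (i < n)%N -> [/\ a <= p i, p i <= q i, q i <= x & `]p i, q i[%classic `<=` U],
  forall i j, (i < j < n)%N -> q i <= p j &
  f x - f a <= e * (x - a) + \sum_(i < n) (f (q i) - f (p i))].
have Pa : P a.
  by exists 0%N, (fun=> 0), (fun=> 0); split => //; rewrite big_ord0; lra.
have step p q : a <= p -> p <= q -> P p ->
    f q - f p <= e * (q - p) \/ `]p, q[%classic `<=` U -> P q.
  move=> ap pq [n [s [t [h1 h2 h3]]]] [h|h].
    exists n, s, t; split=> //; last by move: h3 h; set z := (\sum_(_ < _) _); lra.
    by move=> i /h1[h4 h5 h6 h7]; split=> //; lra.
  exists n.+1, (fun i => if i == n then p else s i), (fun i => if i == n then q else t i).
  split.
  - move=> i; rewrite ltnS leq_eqVlt; case: eqP => [_ _|_ /= /h1[h4 h5 h6 h7]]; split=> //; lra.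
  - move=> i j /andP[ij]; rewrite ltnS leq_eqVlt => jn.
    have -> : (i == n) = false by apply/ltn_eqF; case/orP: jn => [/eqP <-//|]; apply: ltn_trans.
    case: eqP jn ij => [-> _ /h1[]//|_ /= jn ij]; by apply: h2; rewrite ij jn.
  - rewrite big_ord_recr /= eqxx.
    under eq_bigr => i _ do rewrite (ltn_eqF (ltn_ord i)).
    have : 0 <= e * (q - p) by apply: mulr_ge0; lra.
    by move: h3; set z := (\sum_(_ < _) _); lra.
have [n [p [q [h1 h2 h3]]]] : P b.
  pose S := [set x | a <= x <= b /\ P x].
  have hS : has_sup S.
    split; first by exists a; split => //; rewrite lexx.
    by exists b => x [/andP[]].
  have aS : a <= sup S by apply: ub_le_sup; [exact: hS.2|split => //; rewrite lexx].
  have bS : sup S <= b by apply: ge_sup => [|x [/andP[]]//]; exact: hS.1.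
  have [|r r0 hr] := local (sup S); first by rewrite aS.
  have [x [/andP[ax xb] Px] xS] := sup_adherent r0 hS.
  have xs : x <= sup S by apply: ub_le_sup; [exact: hS.2|split => //; rewrite ax].
  pose y := Num.min (sup S + r / 2) b.
  have ys : sup S <= y by rewrite le_min bS andbT; lra.
  have yb : y <= b by rewrite ge_min lexx orbT.
  have Py : P y.
    apply: (step x) => //; first exact: le_trans ys.
    apply: hr => //; rewrite gt_min; apply/orP; left; lra.
  have : y <= sup S by apply: ub_le_sup; [exact: hS.2|split => //; apply/andP; split => //; lra].
  rewrite ge_min => /orP[|bs]; first by lra.
  suff <- : y = b by [].
  by apply/eqP; rewrite eq_le yb /=; exact: le_trans ys.
have := HU n p q h1 h2.
by move: h3; set z := (\sum_(_ < _) _); lra.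
Qed.

End AbsolutelyContinuous.

(** * Derivatives and integrals of continuous functions *)

Section Calculus.
Context {R : realType}.
Notation mu := (@lebesgue_measure R).
Implicit Types (f g k phi : R -> R) (a b t M : R).

Lemma near_lt (t a : R) : t < a -> \forall s \near t, s < a.
Proof. by move=> ta; apply: open_nbhs_nbhs; split => //; exact: open_lt. Qed.

Lemma near_gt (t a : R) : a < t -> \forall s \near t, a < s.
Proof. by move=> ta; apply: open_nbhs_nbhs; split => //; exact: open_gt. Qed.

(** The first-order expansion without division or punctured neighbourhood, so that quadratic
    remainders yield derivatives directly. *)
Lemma is_derive_near (f : R -> R) (t d : R) :
  (forall e, 0 < e -> \forall s \near t, `|f s - f t - d * (s - t)| <= e * `|s - t|) <->
  is_derive t 1 f d.
Proof.
split=> [h|[df fd] e e0].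
  suff H : h^-1 *: (f (h *: (1 : R) + t) - f t) @[h --> 0^'] --> d.
    by split; [apply/cvg_ex; exists d|exact: cvg_lim H].
  apply/cvgrPdist_le => e e0.
  have /nbhs_ballP[r /= r0 hr] := h _ e0.
  apply/nbhs_ballP; exists r => //= x.
  rewrite -ball_normE /= sub0r normrN => xr x0.
  have := hr (x + t); rewrite -ball_normE /= opprD addrCA subrr addr0 normrN => /(_ xr).
  rewrite addrK => hx; rewrite [x *: 1]mulr1.
  have -> : d - x^-1 *: (f (x + t) - f t) = - (x^-1 * (f (x + t) - f t - d * x)).
    by rewrite /GRing.scale /=; field.
  by rewrite normrN normrM normfV ler_pdivrMl ?normr_gt0// [leRHS]mulrC.
move: df => /cvg_ex[l /= hl]; have ld : l = d by rewrite -fd; apply/esym/cvg_lim.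
move: hl; rewrite ld => /cvgrPdist_le /(_ _ e0) /nbhs_ballP[r /= r0 hr].
apply/nbhs_ballP; exists r => //= s; rewrite -ball_normE /= => str.
have [->|st] := eqVneq s t; first by rewrite !subrr mulr0 subrr !normr0 mulr0.
have st0 : s - t != 0 by rewrite subr_eq0.
have := hr (s - t); rewrite -ball_normE /= sub0r normrN distrC => /(_ str st0).
rewrite [_ *: 1]mulr1 subrK.
have -> : d - (s - t)^-1 *: (f s - f t) = - ((s - t)^-1 * (f s - f t - d * (s - t))).
  by rewrite /GRing.scale /=; field.
by rewrite normrN normrM normfV ler_pdivrMl ?normr_gt0// (distrC t) => h; rewrite [leRHS]mulrC.
Qed.

Lemma is_derive_cts (f : R -> R) (t d : R) : is_derive t 1 f d -> {for t, continuous f}.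
Proof. by case=> df _; apply: differentiable_continuous; apply/derivable1_diffP. Qed.

Lemma is_derive_near_eq (f g : R -> R) (t d : R) :
  is_derive t 1 f d -> (\forall s \near t, f s = g s) -> is_derive t 1 g d.
Proof.
move=> /is_derive_near h fg; apply/is_derive_near => e /h hs.
have gt := nbhs_singleton fg.
near=> s; rewrite -gt -(_ : f s = g s); first by near: s.
by near: s.
Unshelve. all: by end_near. Qed.

Lemma lipschitz_of_derive (phi dphi : R -> R) (a b M : R) :
  (forall x, a < x < b -> is_derive x 1 phi (dphi x)) ->
  (forall x, a < x < b -> `|dphi x| <= M) ->
  (forall x, a <= x <= b -> {for x, continuous phi}) ->
  forall x y, a <= x <= b -> a <= y <= b -> `|phi y - phi x| <= M * `|y - x|.
Proof.
move=> dp hM cp x y.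
wlog xy : x y / x < y.
  move=> hw hx hy; have [xy|yx|->] := ltgtP x y; first exact: hw.
    by rewrite distrC (distrC y); exact: hw.
  by rewrite !subrr !normr0 mulr0.
move=> /andP[ax xb] /andP[ay yb].
have [|z|c] := @MVT R phi dphi x y xy.
- by move=> z; rewrite in_itv /= => /andP[h1 h2]; apply: dp; apply/andP; split; lra.
- apply: continuous_in_subspaceT z => z; rewrite inE /= in_itv /= => /andP[h1 h2].
  by apply: cp; apply/andP; split; lra.
rewrite in_itv /= => /andP[h1 h2] ->; rewrite normrM ler_wpM2r//.
by apply: hM; apply/andP; split; lra.
Qed.

Lemma continuous_integrable (g : R -> R) (a b : R) : continuous g ->
  mu.-integrable `[a, b] (EFin \o g).
Proof.
move=> cg; apply: continuous_compact_integrable; first exact: segment_compact.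
exact: continuous_subspaceT.
Qed.

Lemma is_derive_integral (g : R -> R) (t : R) : continuous g -> 0 < t ->
  is_derive t 1 (fun x => \int[mu]_(s in `[0, x]) g s) (g t).
Proof.
move=> cg t0.
have tt : t < t + 1 by rewrite ltrDl.
have [h1 h2] := continuous_FTC1_closed tt (continuous_integrable 0 (t + 1) cg) t0 (cg t).
by split => //; rewrite -derive1E.
Qed.

Lemma bounded_on_segment (g : R -> R) (a b : R) : continuous g ->
  exists2 M : R, 0 <= M & forall s : R, a <= s <= b -> `|g s| <= M.
Proof.
move=> cg; have [ab|ba] := leP a b; last first.
  by exists 0 => // s /andP[? ?]; lra.
have [|c _ hc] := @EVT_max R (fun x => `|g x|) a b ab.
  by apply: continuous_subspaceT => x; apply: cvg_norm; exact: cg.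
by exists `|g c| => // s hs; apply: hc; rewrite in_itv.
Qed.

Lemma integral_norm_le (g : R -> R) (t M : R) : continuous g -> 0 <= t ->
  (forall s, 0 <= s <= t -> `|g s| <= M) -> `|\int[mu]_(s in `[0, t]) g s| <= M * t.
Proof.
move=> cg t0 hM.
apply: le_trans (le_normr_Rintegral _ (continuous_integrable _ _ cg)) _ => //.
apply: le_trans (@le_Rintegral _ _ _ mu `[0, t]%classic (fun s => `|g s|) (fun=> M) _ _ _ _) _.
- exact: measurable_itv.
- by apply: continuous_integrable => x; apply: cvg_norm; exact: cg.
- by apply: continuous_integrable; exact: cst_continuous.
- by move=> x /=; rewrite in_itv /=; exact: hM.
rewrite Rintegral_cst//.
have := lebesgue_measure_itv `[0, t]; rewrite /= lte_fin => h.
rewrite [X in fine X]h; case: ltP => /= t1; first by rewrite subr0.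
have -> : t = 0 by lra.
by rewrite !mulr0.
Qed.

(** The segment is empty or a single point. Primitives and convolutions are thereby extended by 0 to
    negative arguments. *)
Lemma integral_segment0 (g : R -> R) (t : R) : t <= 0 -> \int[mu]_(s in `[0, t]) g s = 0.
Proof.
rewrite le_eqVlt => /orP[/eqP->|t0]; first by rewrite set_itv1 Rintegral_set1.
by rewrite set_itv_ge ?Rintegral_set0// bnd_simp -ltNge.
Qed.

Lemma continuous_integral (g : R -> R) : continuous g ->
  continuous (fun x : R => \int[mu]_(s in `[0, x]) g s).
Proof.
move=> cg t; have [t0|t0|t0] := ltgtP t 0.
- apply/cvgrPdist_le => e e0; near=> s.
  rewrite !integral_segment0 ?subrr ?normr0 ?ltW//.
  by near: s; exact: near_lt.
- exact: is_derive_cts (is_derive_integral cg t0).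
rewrite t0 /continuous_at integral_segment0//; apply/cvgrPdist_le => e e0.
have [M M0 hM] := bounded_on_segment 0 1 cg.
have M1 : 0 < M + 1 by lra.
near=> s; rewrite sub0r normrN.
have [s0|s0] := leP s 0; first by rewrite integral_segment0// normr0 ltW.
have s1 : s <= 1 by apply/ltW; near: s; apply: near_lt; exact: ltr01.
apply: le_trans (integral_norm_le (M := M) cg (ltW s0) _) _.
  by move=> x /andP[x0 xs]; apply: hM; apply/andP; split; lra.
have : s <= e / (M + 1).
  by apply/ltW; near: s; apply: near_lt; rewrite divr_gt0.
rewrite ler_pdivlMr//; nra.
Unshelve. all: by end_near. Qed.

End Calculus.

(** * Convolution on the half-line *)

Section Convolution.
Context {R : realType}.
Notation mu := (@lebesgue_measure R).

Lemma eq_of_derive0 (D : R -> R) (a b : R) : a <= b ->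
  (forall x, a < x < b -> is_derive x 1 D 0) ->
  (forall x, a <= x <= b -> {for x, continuous D}) -> D b = D a.
Proof.
move=> ab dD cD.
have := @lipschitz_of_derive R D (fun=> 0) a b 0 dD _ cD a b.
rewrite !lexx ab normr0 mul0r => /(_ _ isT isT).
move=> h; have := h (fun x _ => lexx _).
by rewrite normr_le0 subr_eq0 => /eqP.
Qed.

Lemma is_derive_add (f g : R -> R) (t a b : R) :
  is_derive t 1 f a -> is_derive t 1 g b -> is_derive t 1 (fun x => f x + g x) (a + b).
Proof. exact: is_deriveD. Qed.

Lemma is_derive_sub (f g : R -> R) (t a b : R) :
  is_derive t 1 f a -> is_derive t 1 g b -> is_derive t 1 (fun x => f x - g x) (a - b).
Proof. exact: is_deriveB. Qed.

Lemma is_derive_scale (f : R -> R) (t a c : R) :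
  is_derive t 1 f a -> is_derive t 1 (fun x => c * f x) (c * a).
Proof. exact: is_deriveZ. Qed.

Lemma is_derive_mul (f g : R -> R) (t a b : R) :
  is_derive t 1 f a -> is_derive t 1 g b ->
  is_derive t 1 (fun x => f x * g x) (a * g t + f t * b).
Proof.
move=> df dg; have := is_deriveM df dg.
by rewrite /GRing.scale /= addrC [g t * a]mulrC.
Qed.

Lemma is_derive_eq_val (f : R -> R) (t a b : R) :
  is_derive t 1 f a -> a = b -> is_derive t 1 f b.
Proof. by move=> h <-. Qed.

Lemma is_derive_sub_left (F : R -> R) (t x d : R) :
  is_derive (t - x) 1 F d -> is_derive x 1 (fun y => F (t - y)) (- d).
Proof.
move=> dF; have -> : - d = d * (-1) by rewrite mulrN1.
apply: (@is_derive1_comp R F (fun y => t - y)) => //.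
have -> : (-1 : R) = 0 - 1 by rewrite sub0r.
exact: (@is_derive_sub (fun=> t) id).
Qed.

Lemma is_derive_shift (F : R -> R) (t x d : R) :
  is_derive (x + t) 1 F d -> is_derive x 1 (fun y => F (y + t)) d.
Proof.
move=> dF; rewrite -[d]mulr1.
apply: (@is_derive1_comp R F (fun y => y + t)) => //.
rewrite -[X in is_derive _ _ _ X]addr0.
exact: (@is_derive_add id (fun=> t)).
Qed.

Lemma continuous_comp_sub (g : R -> R) (t : R) : continuous g ->
  continuous (fun x : R => g (t - x)).
Proof.
move=> cg x; apply: (@continuous_comp R R R (fun x => t - x) g); last exact: cg.
by apply: cvgB; [exact: cvg_cst|exact: cvg_id].
Qed.

Lemma continuousM_fun (g h : R -> R) : continuous g -> continuous h ->
  continuous (fun x : R => g x * h x).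
Proof. by move=> cg ch x; apply: cvgM; [exact: cg|exact: ch]. Qed.

(** The function [D] below has zero derivative on []0, t[], and its values at [t] and at 0 are the
    two sides. *)
Lemma integral_reflection (h : R -> R) (t : R) : continuous h -> 0 <= t ->
  \int[mu]_(s in `[0, t]) h (t - s) = \int[mu]_(s in `[0, t]) h s.
Proof.
move=> ch t0.
have cht := @continuous_comp_sub h t ch.
pose D x := \int[mu]_(s in `[0, x]) h (t - s) + \int[mu]_(s in `[0, t - x]) h s.
have : D t = D 0.
  apply: eq_of_derive0 => // x.
    move=> /andP[x0 xt].
    have d1 := is_derive_integral cht x0.
    have tx : 0 < t - x by lra.
    have d2 := is_derive_sub_left (is_derive_integral ch tx).
    by apply: is_derive_eq_val (is_derive_add d1 d2) _; rewrite subrr.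
  move=> _; apply: cvgD; first exact: continuous_integral.
  exact: (@continuous_comp_sub _ t (continuous_integral ch)).
by rewrite /D subrr subr0 !(integral_segment0 _ (lexx 0)) addr0 add0r.
Qed.

Definition conv (k phi : R -> R) (t : R) : R :=
  \int[mu]_(s in `[0, t]) (k (t - s) * phi s).

Lemma convE (k phi : R -> R) (t : R) : continuous k -> continuous phi -> 0 <= t ->
  conv k phi t = \int[mu]_(r in `[0, t]) (k r * phi (t - r)).
Proof.
move=> ck cphi t0.
rewrite -(integral_reflection (h := fun r => k r * phi (t - r))) //.
  by apply: eq_Rintegral => s _; have -> : t - (t - s) = s by lra.
by apply: continuousM_fun => //; exact: continuous_comp_sub.
Qed.

(** Written as the integral of [k r * phi (t - r)], the convolution depends on [t] through [phi] and
    through the upper limit. The first dependence is handled under the integral sign over the fixed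
    segment [[0, t]], the second gives [k t * phi 0], and the interaction of the two is
    quadratically small. *)
Lemma is_derive_conv (k phi dphi : R -> R) (t : R) :
  continuous k -> continuous phi -> continuous dphi ->
  (forall x : R, 0 < x -> is_derive x 1 phi (dphi x)) -> 0 < t ->
  is_derive t 1 (conv k phi) (k t * phi 0 + conv k dphi t).
Proof.
move=> ck cphi cdphi dphiP t0.
(* [psi] is a continuously differentiable extension of [phi] to negative arguments. *)
pose h x := dphi (Num.max (x - (t + 1)) 0).
have ch : continuous h.
  move=> x; apply: (@continuous_comp R R R (fun x => Num.max (x - (t + 1)) 0) dphi);
    last exact: cdphi.
  apply: (@continuous_max R R (fun x => x - (t + 1)) (fun=> 0)); last exact: cst_continuous.
  by apply: cvgB; [exact: cvg_id|exact: cvg_cst].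
(* The base point of the primitive is shifted to [- (t + 1)], to the left of every argument [x - r]
   that occurs, because primitives are differentiated at positive upper limits only. *)
pose H x := \int[mu]_(s in `[0, x]) h s.
have cH : continuous H by exact: continuous_integral.
pose psi x := H (x + (t + 1)) + (phi 0 - H (t + 1)).
have cpsi : continuous psi.
  move=> x; apply: cvgD; last exact: cvg_cst.
  apply: (@continuous_comp R R R (fun x => x + (t + 1)) H); last exact: cH.
  by apply: cvgD; [exact: cvg_id|exact: cvg_cst].
pose dpsi (x : R) := dphi (Num.max x 0).
have cdpsi : continuous dpsi.
  move=> x; apply: (@continuous_comp R R R (fun x => Num.max x 0) dphi); last exact: cdphi.
  apply: (@continuous_max R R id (fun=> 0)); last exact: cst_continuous.
  exact: cvg_id.
have dpsiP (x : R) : - (t + 1) < x -> is_derive x 1 psi (dpsi x).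
  move=> xt; have xt0 : 0 < x + (t + 1) by lra.
  have d1 := is_derive_shift (is_derive_integral ch xt0).
  apply: is_derive_eq_val (is_derive_add d1 (is_derive_cst (phi 0 - H (t + 1)) x 1)) _.
  by rewrite addr0 /h addrK.
have psi0 : psi 0 = phi 0 by rewrite /psi add0r addrC subrK.
have psiE (x : R) : 0 <= x -> psi x = phi x.
  move=> x0; apply/eqP; rewrite -subr_eq0; apply/eqP.
  rewrite -(subrr (phi 0)) -{1}psi0.
  apply: (@eq_of_derive0 (fun y => psi y - phi y)) => // y.
    move=> /andP[y0 yx]; have -> : (0 : R) = dpsi y - dphi y.
      by rewrite /dpsi max_l ?subrr// ltW.
    by apply: is_derive_sub; [apply: dpsiP; lra|exact: dphiP].
  by move=> _; apply: cvgB; [exact: cpsi|exact: cphi].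
have [Mk Mk0 hMk] := bounded_on_segment 0 (t + 1) ck.
have [Mp Mp0 hMp] := bounded_on_segment (- t) (t + 1) cdpsi.
pose c2 x := \int[mu]_(r in `[0, t]) (k r * psi (x - r)).
have cG x : continuous (fun r : R => k r * psi (x - r)).
  by apply: continuousM_fun => //; exact: continuous_comp_sub.
have dfib (x r : R) : 0 < x -> 0 <= r <= t ->
  is_derive x 1 (fun y => k r * psi (y - r)) (k r * dpsi (x - r)).
  move=> x0 /andP[r0 rt].
  have : is_derive (x - r) 1 psi (dpsi (x - r)) by apply: dpsiP; lra.
  move=> /(@is_derive_shift psi (- r)) hd.
  exact: is_derive_scale.
have dc2 : is_derive t 1 c2 (conv k dphi t).
  have -> : conv k dphi t = \int[mu]_(r in `[0, t]) (k r * dpsi (t - r)).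
    rewrite convE ?ltW//; apply: eq_Rintegral => r.
    by rewrite inE /= in_itv /= => /andP[r0 rt]; rewrite /dpsi max_l// subr_ge0.
  have mD : measurable `[0, t]%classic by exact: measurable_itv.
  have ta : `]0, (t + 1)[%classic t by rewrite /= in_itv /=; apply/andP; split; lra.
  have h1 (x : R) : `]0, (t + 1)[%classic x ->
    mu.-integrable `[0, t] (EFin \o (fun r => k r * psi (x - r))).
    by move=> _; exact: continuous_integrable.
  have h2 (x r : R) : `]0, (t + 1)[%classic x -> `[0, t]%classic r ->
    derivable (fun y => k r * psi (y - r)) x 1.
    move=> /=; rewrite !in_itv /= => /andP[x0 _] hr; have := dfib x r x0 hr; by case.
  have h3 (x r : R) : `]0, (t + 1)[%classic x -> `[0, t]%classic r ->
      `|partial1of2 (fun y r => k r * psi (y - r)) x r| <= Mk * Mp.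
    move=> /=; rewrite !in_itv /= => /andP[x0 xt] hr.
    rewrite partial1of2E; have [_ ->] := dfib x r x0 hr.
    move: hr => /andP[r0 rt].
    rewrite normrM ler_pM//; first by apply: hMk; apply/andP; split; lra.
    by apply: hMp; apply/andP; split; lra.
  have hG : mu.-integrable `[0, t] (EFin \o (fun=> Mk * Mp)).
    by apply: continuous_integrable; exact: cst_continuous.
  have G0 : forall y : R, 0 <= (fun=> Mk * Mp) y by move=> _; exact: mulr_ge0.
  split.
    exact: (@derivable_under_integral _ _ _ mu (fun y r => k r * psi (y - r)) _ mD _ _ _ ta h1
      h2 _ G0 hG h3).
  rewrite -derive1E (@differentiation_under_integral _ _ _ mu (fun y r => k r * psi (y - r)) _
    mD _ _ _ ta h1 h2 _ G0 hG h3).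
  apply: eq_Rintegral => r; rewrite inE /= in_itv /= => hr.
  rewrite partial1of2E; by have [_ ->] := dfib t r t0 hr.
pose K x := \int[mu]_(r in `[0, x]) k r.
have dK : is_derive t 1 K (k t) by exact: is_derive_integral.
pose rem s := conv k phi s - c2 s - phi 0 * (K s - K t).
have remt : rem t = 0.
  rewrite /rem subrr mulr0 subr0 convE ?ltW// /c2.
  apply/eqP; rewrite subr_eq0; apply/eqP; apply: eq_Rintegral => r.
  by rewrite inE /= in_itv /= => /andP[r0 rt]; rewrite psiE// subr_ge0.
(* [rem s] is the integral of [G] from [t] to [s]; between these points [s - r] is at most [|s - t|]
   in absolute value, so both the integrand and the length of the interval are of order
   [|s - t|]. *)
have hrem (s : R) : 0 < s -> s < t + 1 -> `|rem s| <= Mk * Mp * `|s - t| * `|s - t|.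
  move=> s0 st1.
  pose G r := k r * (psi (s - r) - phi 0).
  have cGs : continuous G.
    apply: continuousM_fun => // r; apply: cvgB; last exact: cvg_cst.
    exact: continuous_comp_sub.
  have intG x : \int[mu]_(r in `[0, x]) G r =
      \int[mu]_(r in `[0, x]) (k r * psi (s - r)) - phi 0 * K x.
    rewrite /K -RintegralZl//; last exact: continuous_integrable.
    rewrite -RintegralB//.
    - by apply: eq_Rintegral => r _; rewrite /G mulrBr [k r * phi 0]mulrC.
    - exact: continuous_integrable.
    - apply: (@continuous_integrable _ (fun x => phi 0 * k x)).
      by apply: continuousM_fun => //; exact: cst_continuous.
  have -> : rem s = \int[mu]_(r in `[0, s]) G r - \int[mu]_(r in `[0, t]) G r.
    rewrite !intG /rem convE ?ltW//.
    have -> : \int[mu]_(r in `[0, s]) (k r * phi (s - r)) =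
              \int[mu]_(r in `[0, s]) (k r * psi (s - r)).
      apply: eq_Rintegral => r.
      by rewrite inE /= in_itv /= => /andP[r0 rs]; rewrite psiE// subr_ge0.
    rewrite /c2; ring.
  have hb (r : R) : Num.min s t < r < Num.max s t -> `|G r| <= Mk * Mp * `|s - t|.
    rewrite gt_min lt_max => /andP[h1 h2].
    have srt : `|s - r| <= `|s - t|.
      have [st|ts] := leP s t.
        by rewrite !ler0_norm; lra.
      by rewrite !ger0_norm; lra.
    have r01 : 0 <= r <= t + 1 by apply/andP; split; lra.
    rewrite /G normrM -mulrA ler_pM//; first exact: hMk.
    rewrite -psi0; apply: le_trans (_ : Mp * `|s - r - 0| <= _); last first.
      by rewrite subr0 ler_wpM2l.
    apply: (@lipschitz_of_derive R psi dpsi (- t) (t + 1)).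
    - by move=> x /andP[x0 x1]; apply: dpsiP; lra.
    - by move=> x /andP[x0 x1]; apply: hMp; apply/andP; split; lra.
    - by move=> x _; exact: cpsi.
    - by apply/andP; split; lra.
    - by apply/andP; split; lra.
  apply: (@lipschitz_of_derive R (fun x => \int[mu]_(r in `[0, x]) G r) G (Num.min s t) (Num.max
    s t)) => //.
  - move=> x /andP[x0 _]; apply: is_derive_integral => //.
    by apply: lt_trans x0; rewrite lt_min s0.
  - by move=> x _; exact: continuous_integral.
  - by rewrite ge_min le_max lexx !orbT.
  - by rewrite ge_min le_max lexx.
have drem : is_derive t 1 rem 0.
  apply/is_derive_near => e e0.
  have M1 : 0 < Mk * Mp + 1 by have := mulr_ge0 Mk0 Mp0; lra.
  have e1 : 0 < e / (Mk * Mp + 1) by rewrite divr_gt0.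
  near=> s; rewrite remt subr0 mul0r subr0.
  apply: le_trans (hrem _ _ _) _.
  - by near: s; exact: near_gt.
  - by near: s; apply: near_lt; lra.
  rewrite ler_wpM2r//.
  have : `|t - s| < e / (Mk * Mp + 1).
    by near: s; apply/nbhs_ballP; exists (e / (Mk * Mp + 1)) => //= s; rewrite -ball_normE.
  rewrite ltr_pdivlMr// distrC; have := normr_ge0 (s - t); nra.
have -> : conv k phi = (fun s => rem s + c2 s + phi 0 * (K s - K t)).
  by apply/funext => s; rewrite /rem; ring.
have d3 := is_derive_scale (phi 0) (is_derive_sub dK (is_derive_cst (K t) t 1)).
apply: is_derive_eq_val (is_derive_add (is_derive_add drem dc2) d3) _; ring.
Unshelve. all: by end_near. Qed.

End Convolution.

(** * The memory kernel *)

Section Kernel.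
Context {R : realType}.
Notation mu := (@lebesgue_measure R).

Lemma absolutely_continuous_on_sub (f : R -> R) (a b c d : R) : a <= c -> d <= b ->
  absolutely_continuous_on a b f -> absolutely_continuous_on c d f.
Proof.
move=> ac db fac e e0; have [dl dl0 h] := fac _ e0.
exists dl => // n p q hpq; apply: h => i.
by have [h1 [h2 h3]] := hpq i; split; [lra|split => //; lra].
Qed.

(** Transfers absolute continuity from [k] to expressions combining [k] with Lipschitz functions,
    and to its extension to negative arguments. *)
Lemma absolutely_continuous_on_majorant (f g : R -> R) (a b M : R) : 0 <= M ->
  (forall p q, a <= p -> p <= q -> q <= b -> `|g q - g p| <= M * (`|f q - f p| + (q - p))) ->
  absolutely_continuous_on a b f -> absolutely_continuous_on a b g.
Proof.
move=> M0 gf fac e e0.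
have M1 : 0 < M + 1 by lra.
pose e' := e / (M + 1) / 2; have e'0 : 0 < e' by rewrite !divr_gt0.
have [d d0 h] := fac _ e'0.
exists (Num.min d e'); first by rewrite lt_min d0.
move=> n p q hpq triv; rewrite lt_min => /andP[h1 h2].
apply: (@le_lt_trans _ _ (\sum_(i < n) (M * (`|f (q i) - f (p i)| + (q i - p i))))).
  by apply: ler_sum => i _; have [? [? ?]] := hpq i; apply: gf.
rewrite -mulr_sumr big_split /=.
have := h n p q hpq triv h1.
have : 0 <= \sum_(i < n) `|f (q i) - f (p i)| by apply: sumr_ge0.
have : 0 <= \sum_(i < n) (q i - p i).
  by apply: sumr_ge0 => i _; have [? [? ?]] := hpq i; lra.
have ee : e = 2 * (M + 1) * e' by rewrite /e'; field; lra.
move: h2; rewrite ee; set x := \sum_(_ < _) _; set y := \sum_(_ < _) _; nra.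
Qed.

Lemma locally_absolutely_continuous_continuous (f : R -> R) :
  locally_absolutely_continuous f -> continuous (fun x : R => f (Num.max x 0)).
Proof.
move=> fac x; apply/cvgrPdist_lt => e e0.
pose T := `|x| + 2; have T0 : 0 < T by rewrite /T; have := normr_ge0 x; lra.
have [d d0 h] := fac T T0 _ e0.
have key p q : 0 <= p -> p <= q -> q <= T -> q - p < d -> `|f q - f p| < e.
  move=> p0 pq qT pqd; have := h 1%N (fun=> p) (fun=> q).
  rewrite !big_ord1; apply => // i j _ _ _; rewrite !ord1//.
have xT : Num.max x 0 <= `|x| by rewrite ge_max normr_ge0 ler_norm.
have m0 : 0 < Num.min d 1 by rewrite lt_min d0 ltr01.
apply/nbhs_ballP; exists (Num.min d 1) => //= y.
rewrite /ball_ /= lt_min => /andP[hd h1].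
have hm : `|Num.max x 0 - Num.max y 0| <= `|x - y|.
  case: (leP x 0) => hx; case: (leP y 0) => hy; rewrite ?subrr ?normr0//.
  - by rewrite sub0r normrN (ger0_norm (ltW hy)) distrC ger0_norm; lra.
  - by rewrite subr0 !ger0_norm; lra.
have yT : Num.max y 0 <= T.
  have : Num.max y 0 <= Num.max x 0 + `|Num.max x 0 - Num.max y 0|.
    by rewrite distrC -lerBlDl ler_norm.
  rewrite /T; lra.
have n0 (z : R) : 0 <= Num.max z 0 by rewrite le_max lexx orbT.
have [xy|yx] := leP (Num.max x 0) (Num.max y 0).
  by rewrite distrC; apply: key => //; move: hm; rewrite distrC ger0_norm; lra.
apply: key => //; first exact: ltW.
  by rewrite /T; lra.
by move: hm; rewrite ger0_norm; lra.
Qed.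

Variables (k : R -> R) (eta : R).
Hypotheses (eta0 : 0 < eta) (ck : continuous k)
  (kac : locally_absolutely_continuous k)
  (kdecay : {ae mu, forall x : R, 0 < x -> derivable k x 1 /\ derive1 k x <= - eta * k x}).

(* The inequality [- k' >= eta k] tested against [phi] and integrated by parts. *)
Lemma kernel_decay (phi dphi : R -> R) (a b : R) : 0 <= a -> a <= b ->
  continuous phi -> continuous dphi ->
  (forall x : R, a < x < b -> is_derive x 1 phi (dphi x)) ->
  (forall x : R, a <= x <= b -> 0 <= phi x) ->
  k b * phi b - \int[mu]_(r in `[0, b]) (k r * dphi r)
    + eta * \int[mu]_(r in `[0, b]) (k r * phi r) <=
  k a * phi a - \int[mu]_(r in `[0, a]) (k r * dphi r)
    + eta * \int[mu]_(r in `[0, a]) (k r * phi r).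
Proof.
move=> a0 ab cphi cdphi dphiP phi0.
(* Almost everywhere [G' = (k' + eta k) phi <= 0]: the first integral removes the term [k phi'] of
   the product rule, so [k'] is never integrated. *)
pose G x := k x * phi x - \int[mu]_(r in `[0, x]) (k r * dphi r)
  + eta * \int[mu]_(r in `[0, x]) (k r * phi r).
rewrite -/(G b) -/(G a).
have ck1 : continuous (fun r : R => k r * dphi r) by exact: continuousM_fun.
have ck2 : continuous (fun r : R => k r * phi r) by exact: continuousM_fun.
have [Mk Mk0 hMk] := bounded_on_segment a b ck.
have [Mp Mp0 hMp] := bounded_on_segment a b cphi.
have [Md Md0 hMd] := bounded_on_segment a b cdphi.
apply: (@absolutely_continuous_nonincreasing R G a b ab).
  pose M := Mp + Mk * Md + Mk * Md + eta * (Mk * Mp).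
  have M0 : 0 <= M by rewrite /M !addr_ge0// !mulr_ge0// ltW.
  apply: (@absolutely_continuous_on_majorant k G a b M M0); last first.
    apply: (@absolutely_continuous_on_sub k 0 (b + 1)) => //; first lra.
    by apply: kac; lra.
  move=> p q ap pq qb.
  have pab : a <= p <= b by apply/andP; split; lra.
  have qab : a <= q <= b by apply/andP; split; lra.
  have sub (x : R) : a < x < b -> a <= x <= b by move=> /andP[? ?]; apply/andP; split; lra.
  have pos (x : R) : a < x < b -> 0 < x by move=> /andP[? ?]; lra.
  have qp : `|q - p| = q - p by rewrite ger0_norm; lra.
  have l1 : `|phi q - phi p| <= Md * (q - p).
    rewrite -qp; apply: (@lipschitz_of_derive R phi dphi a b) => //.
    - by move=> x /sub; exact: hMd.
    - by move=> x _; exact: cphi.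
  have l2 : `|\int[mu]_(r in `[0, q]) (k r * dphi r) - \int[mu]_(r in `[0, p]) (k r * dphi r)|
      <= Mk * Md * (q - p).
    rewrite -qp; apply: (@lipschitz_of_derive R (fun x => \int[mu]_(r in `[0, x]) (k r * dphi r))
      (fun r => k r * dphi r) a b) => //.
    - by move=> x /pos x0; exact: is_derive_integral.
    - by move=> x /sub hx; rewrite normrM ler_pM// ?hMk ?hMd.
    - by move=> x _; exact: continuous_integral.
  have l3 : `|\int[mu]_(r in `[0, q]) (k r * phi r) - \int[mu]_(r in `[0, p]) (k r * phi r)|
      <= Mk * Mp * (q - p).
    rewrite -qp; apply: (@lipschitz_of_derive R (fun x => \int[mu]_(r in `[0, x]) (k r * phi r))
      (fun r => k r * phi r) a b) => //.
    - by move=> x /pos x0; exact: is_derive_integral.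
    - by move=> x /sub hx; rewrite normrM ler_pM// ?hMk ?hMp.
    - by move=> x _; exact: continuous_integral.
  rewrite /G; move: l2 l3; set I1q := \int[mu]_(r in _) _; set I1p := \int[mu]_(r in _) _.
  set I2q := \int[mu]_(r in _) _; set I2p := \int[mu]_(r in _) _ => l2 l3.
  have -> : k q * phi q - I1q + eta * I2q - (k p * phi p - I1p + eta * I2p) =
    ((k q - k p) * phi q + k p * (phi q - phi p)) + (- (I1q - I1p) + eta * (I2q - I2p)) by ring.
  apply: le_trans (ler_normD _ _) _.
  have n1 := ler_normD ((k q - k p) * phi q) (k p * (phi q - phi p)).
  have n2 := ler_normD (- (I1q - I1p)) (eta * (I2q - I2p)).
  rewrite normrN normrM (gtr0_norm eta0) in n2; rewrite !normrM in n1.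
  have m1 : `|k q - k p| * `|phi q| <= Mp * `|k q - k p| by rewrite mulrC ler_wpM2r// hMp.
  have m2 : `|k p| * `|phi q - phi p| <= Mk * Md * (q - p) by rewrite -mulrA ler_pM// hMk.
  have m3 : eta * `|I2q - I2p| <= eta * (Mk * Mp * (q - p)) by rewrite ler_wpM2l// ltW.
  have m4 : 0 <= (M - Mp) * `|k q - k p|.
    by rewrite mulr_ge0// /M; have := mulr_ge0 Mk0 Md0;
      have := mulr_ge0 (ltW eta0) (mulr_ge0 Mk0 Mp0); lra.
  have m5 : 0 <= Mp * (q - p) by rewrite mulr_ge0//; lra.
  move: n1 n2 m1 m2 m3 m4; rewrite /M; nra.
have [N [mN N0 HN]] := kdecay.
exists N; split => // x hnx; apply: HN => hx; apply: hnx => /andP[ax xb].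
have x0 : 0 < x by lra.
have [dk kd] := hx x0.
have dK : is_derive x 1 k (derive1 k x) by split => //; rewrite derive1E.
have d1 := is_derive_mul dK (dphiP x _).
rewrite ax xb in d1.
have dG := is_derive_add (is_derive_sub (d1 isT) (is_derive_integral ck1 x0))
   (is_derive_scale eta (is_derive_integral ck2 x0)).
have [dGx dGv] : is_derive x 1 G _ := dG.
split => //; rewrite derive1E dGv.
have px : 0 <= phi x by apply: phi0; rewrite (ltW ax) (ltW xb).
have := ler_wpM2r px kd; lra.
Qed.

(** The right-hand side is the integral of [(- k')(t - s) chi(s)] over [[0, t]] after integration by
    parts. It is obtained from [kernel_decay] on [[0, t]] with the reflected function
    [chi (t - r)]. *)
Lemma conv_dissipation (chi dchi : R -> R) (t : R) : 0 <= t ->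
  continuous chi -> continuous dchi ->
  (forall x : R, 0 < x -> is_derive x 1 chi (dchi x)) ->
  (forall x : R, 0 <= x <= t -> 0 <= chi x) ->
  eta * conv k chi t <= k 0 * chi t - k t * chi 0 - conv k dchi t.
Proof.
move=> t0 cchi cdchi dchiP chi0.
have := @kernel_decay (fun r => chi (t - r)) (fun r => - dchi (t - r)) 0 t (lexx 0) t0.
have cm : continuous (fun r : R => - dchi (t - r)).
  by move=> x; apply: cvgN; exact: (@continuous_comp_sub R dchi t cdchi x).
move=> /(_ (@continuous_comp_sub R chi t cchi) cm) /=.
have h1 (x : R) : 0 < x < t -> is_derive x 1 (fun r => chi (t - r)) (- dchi (t - x)).
  by move=> /andP[x0 xt]; apply: is_derive_sub_left; apply: dchiP; lra.
have h2 (x : R) : 0 <= x <= t -> 0 <= chi (t - x).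
  by move=> /andP[x0 xt]; apply: chi0; apply/andP; split; lra.
move=> /(_ h1 h2).
rewrite !(integral_segment0 _ (lexx 0)) subrr !subr0 mulr0 addr0.
rewrite !convE//.
have -> : \int[mu]_(r in `[0, t]) (k r * - dchi (t - r)) =
   - \int[mu]_(r in `[0, t]) (k r * dchi (t - r)).
  rewrite -mulN1r -RintegralZl//; first by apply: eq_Rintegral => r _; rewrite mulN1r mulrN.
  by apply: continuous_integrable; apply: continuousM_fun => //; exact: continuous_comp_sub.
lra.
Qed.

Lemma kernel_decay_integral (a b : R) : 0 <= a -> a <= b ->
  k b + eta * \int[mu]_(r in `[0, b]) k r <= k a + eta * \int[mu]_(r in `[0, a]) k r.
Proof.
move=> a0 ab.
have dc (x : R) : a < x < b -> is_derive x 1 (fun=> 1 : R) (0 : R).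
  by move=> _; exact: is_derive_cst.
have := @kernel_decay (fun=> 1) (fun=> 0) a b a0 ab (@cst_continuous _ _ _) (@cst_continuous _ _
  _) dc (fun _ _ => ler01).
have e0 (x : R) : \int[mu]_(r in `[0, x]) (k r * 0) = 0.
  by under eq_Rintegral do rewrite mulr0; rewrite Rintegral_cst// mul0r.
have e1 (x : R) : \int[mu]_(r in `[0, x]) (k r * 1) = \int[mu]_(r in `[0, x]) k r.
  by under eq_Rintegral do rewrite mulr1.
by rewrite !e0 !e1 !mulr1 !subr0.
Qed.

Hypotheses (k_ge0 : forall t, 0 <= k t)
  (kint : (\int[mu]_(t in `[0%R, +oo[) (k t)%:E = 1)%E).

Lemma integral_kernel_cvg : \int[mu]_(r in `[0, n%:R]) k r @[n --> \oo] --> (1 : R).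
Proof.
have mk : measurable_fun setT k by exact: continuous_measurable_fun.
have := ge0_cvgn_integral (mu := mu) k_ge0 mk; rewrite kint => h.
exact: (fine_cvg h).
Qed.

Lemma integral_kernel_le (s t : R) : 0 <= s -> s <= t ->
  \int[mu]_(r in `[0, s]) k r <= \int[mu]_(r in `[0, t]) k r.
Proof.
move=> s0 st; apply: (@ger0_derive1_le_cc R (fun x => \int[mu]_(r in `[0, x]) k r) 0 t).
- by move=> x; rewrite in_itv /= => /andP[x0 _]; have [] := is_derive_integral ck x0.
- move=> x; rewrite in_itv /= => /andP[x0 _]; have [_ h] := is_derive_integral ck x0.
  by rewrite derive1E h.
- by apply: continuous_subspaceT => x; exact: continuous_integral.
- by rewrite in_itv /= s0.
- by rewrite in_itv /= lexx (le_trans s0).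
- by [].
Qed.

Lemma integral_kernel_le1 (t : R) : \int[mu]_(r in `[0, t]) k r <= 1.
Proof.
have [t0|/ltW t0] := leP t 0; first by rewrite integral_segment0 ?ler01.
have hc : (fun=> \int[mu]_(r in `[0, t]) k r) @ \oo --> \int[mu]_(r in `[0, t]) k r by exact:
  cvg_cst.
apply: (ler_cvg_to hc integral_kernel_cvg).
near=> n; apply: integral_kernel_le => //.
by near: n; exact: nbhs_infty_ger.
Unshelve. all: by end_near. Qed.

(** Integrating [- k' >= eta k] from [t] to [n] and dropping [k n >= 0] leaves the tail of the
    kernel, whose total mass is 1, as [n] goes to infinity. *)
Lemma kernel_tail (t : R) : 0 <= t -> eta * (1 - \int[mu]_(r in `[0, t]) k r) <= k t.
Proof.
move=> t0.
suff : eta * 1 <= k t + eta * \int[mu]_(r in `[0, t]) k r by lra.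
have h1 : eta * \int[mu]_(r in `[0, n%:R]) k r @[n --> \oo] --> eta * 1.
  by apply: cvgM; [exact: cvg_cst|exact: integral_kernel_cvg].
have hc : (fun=> k t + eta * \int[mu]_(r in `[0, t]) k r) @ \oo -->
    k t + eta * \int[mu]_(r in `[0, t]) k r by exact: cvg_cst.
apply: (ler_cvg_to h1 hc).
near=> n.
have tn : t <= n%:R by near: n; exact: nbhs_infty_ger.
by have := kernel_decay_integral t0 tn; have := k_ge0 n%:R; lra.
Unshelve. all: by end_near. Qed.

End Kernel.

(** * Resolvents of a positive self-adjoint operator *)

Section Regularization.
Context {R : realType} {H : completeNormedModType R}.
Variables (dot : {dot H for @idfun R}) (B : linear_operator H).
Hypotheses (hdot : hilbert_norm dot) (hB : self_adjoint dot B).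

Lemma self_adjoint_sym x y : op_dom B x -> op_dom B y -> dot (B x) y = dot x (B y).
Proof. by move=> hx hy; have [_ /(_ y (B y)) [/(_ (conj hy erefl)) h _]] := hB; exact: h. Qed.

Lemma op_domZ a x : op_dom B x -> op_dom B (a *: x).
Proof. by move=> hx; rewrite -[a *: x]addr0; apply: op_domP => //; exact: op_dom0. Qed.

Lemma op_domB x y : op_dom B x -> op_dom B y -> op_dom B (x - y).
Proof. by move=> hx hy; rewrite addrC -scaleN1r; exact: op_domP. Qed.

Lemma op_funB x y : op_dom B x -> op_dom B y -> B (x - y) = B x - B y.
Proof. by move=> hx hy; rewrite addrC -scaleN1r op_linear// scaleN1r addrC. Qed.

Lemma op_funZ a x : op_dom B x -> B (a *: x) = a *: B x.
Proof.
move=> hx; have B0 : B 0 = 0.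
  by have := op_funB (op_dom0 B) (op_dom0 B); rewrite !subrr.
by rewrite -[a *: x]addr0 op_linear//; [rewrite B0 addr0|exact: op_dom0].
Qed.

(** The graph of an adjoint is defined by scalar product identities, which pass to the limit. *)
Lemma self_adjoint_closed (y : nat -> H) (l w : H) : (forall n, op_dom B (y n)) ->
  y @ \oo --> l -> B (y n) @[n --> \oo] --> w -> op_dom B l /\ B l = w.
Proof.
move=> yD yl yw; have [_ h] := hB; apply/h => x xD.
have h1 : dot (y n) (B x) @[n --> \oo] --> dot l (B x) by exact: dot_cvg.
have h2 : dot (B (y n)) x @[n --> \oo] --> dot w x by exact: dot_cvg.
have h3 : (fun n => dot (B (y n)) x) = (fun n => dot (y n) (B x)).
  by apply/funext => n; rewrite self_adjoint_sym.
rewrite h3 in h2; rewrite dotC (dotC _ x).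
exact: (cvg_unique _ h1 h2).
Qed.

Hypothesis pB : positive_operator dot B.

Lemma resolvent_bound (l : R) y : 0 < l -> op_dom B y -> l * `|y| <= `|B y + l *: y|.
Proof.
move=> l0 yD; have [->|y0] := eqVneq y 0; first by rewrite normr0 mulr0.
rewrite -(ler_pM2r (_ : 0 < `|y|)) ?normr_gt0//.
apply: le_trans (le_trans (ler_norm _) (dot_le_norm hdot _ _)).
rewrite -mulrA -expr2 hdot dotDl dotZl lerDr; exact: pB.
Qed.

(** The range of [B + l] is closed by [resolvent_bound] and closedness of [B]. A vector [r]
    orthogonal to it belongs to the domain of the adjoint, that is of [B], with [B r = - l r];
    positivity forces [r = 0]. *)
Lemma resolvent_exists (l : R) : 0 < l -> forall x, exists2 y, op_dom B y & B y + l *: y = x.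
Proof.
move=> l0 x.
pose M := [set z | exists2 y, op_dom B y & B y + l *: y = z].
have Mlin a y z : M y -> M z -> M (a *: y + z).
  move=> [y' hy <-] [z' hz <-]; exists (a *: y' + z'); first exact: op_domP.
  by rewrite op_linear// !scalerDr !scalerA (mulrC l) !addrA; congr (_ + _); rewrite -!addrA;
    congr (_ + _); rewrite addrC.
have M0 : M 0.
  exists 0; first exact: op_dom0.
  by rewrite scaler0 addr0 -(scale0r (0 : H)) op_funZ ?scale0r//; exact: op_dom0.
have Mcl : closed M.
  move=> z hz.
  have /choice[y hy] n : exists y, op_dom B y /\ `|z - (B y + l *: y)| < n.+1%:R^-1.
    have n0 : (0 : R) < n.+1%:R^-1 by rewrite invr_gt0.
    have [_ [[y yD <-] hzy]] := hz _ (nbhsx_ballx z _ n0).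
    by exists y; split => //; move: hzy; rewrite -ball_normE.
  pose zz n := B (y n) + l *: y n.
  have zc : zz @ \oo --> z.
    apply/cvgrPdist_lt => e e0.
    have := @cvg_harmonic R => /cvgrPdist_lt/(_ _ e0); apply: filterS => n.
    rewrite sub0r normrN ger0_norm ?invr_ge0//; apply: lt_trans.
    by have [] := hy n.
  have cy : cauchy (y @ \oo).
    apply: cauchy_exP => e e0.
    have le0 : 0 < l * e / 2 by rewrite divr_gt0// mulr_gt0.
    have /cvgrPdist_lt/(_ _ le0)[N _ hN] := zc.
    exists (y N); exists N => //= n /= Nn; rewrite -ball_normE /=.
    rewrite -(ltr_pM2l l0).
    apply: le_lt_trans (resolvent_bound l0 (op_domB (hy N).1 (hy n).1)) _.
    have -> : B (y N - y n) + l *: (y N - y n) = (z - zz n) - (z - zz N).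
      rewrite op_funB ?scalerBr; [|by have [] := hy N|by have [] := hy n].
      by rewrite opprB (addrC (z - zz n)) [RHS]addrA subrK /zz opprD addrACA.
    apply: le_lt_trans (ler_normB _ _) _.
    have := hN _ Nn; have := hN N (leqnn N); rewrite /=; lra.
  have /cvg_ex[w yw] : cvg (y @ \oo) by exact: cauchy_cvg.
  have yB : B (y n) @[n --> \oo] --> z - l *: w.
    have -> : (fun n => B (y n)) = (fun n => zz n - l *: y n).
      by apply/funext => n; rewrite /zz addrK.
    by apply: cvgB => //; exact: cvgZr.
  have [wD Bw] := self_adjoint_closed (fun n => (hy n).1) yw yB.
  by exists w => //; rewrite Bw subrK.
have [m [y yD <-] hm] := projection_theorem hdot x Mcl M0 Mlin.
set r := x - _ in hm.
have [rD Br] : op_dom B r /\ B r = (- l) *: r.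
  have [_ h] := hB; apply/h => v vD.
  have : dot r (B v + l *: v) = 0 by apply: hm; exists v.
  rewrite dotDr !dotZr (dotC dot r (B v)) (dotC dot r v); lra.
have r0 : r = 0.
  apply/eqP; rewrite -normr_eq0 -sqrf_eq0 hdot; apply/eqP.
  have := pB rD; rewrite Br dotZl; have := dot_ge0 hdot r; nra.
by exists y => //; apply/esym/eqP; rewrite -subr_eq0 -/r r0.
Qed.

(* Satisfied by [J = (l (B + l)^-1) ^ 2] for every [l > 0]. *)
Record regularizer (C : R) (J K : H -> H) : Prop := Regularizer {
  reg_sym : forall x y, dot (J x) y = dot x (J y) ;
  reg_dom : forall x, op_dom B (J x) ;
  reg_opE : forall x, B (J x) = K x ;
  reg_op_sym : forall x y, dot (K x) y = dot x (K y) ;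
  reg_comm : forall x, op_dom B x -> K x = J (B x) ;
  reg_swap : forall x y, dot (J x) (K y) = dot (K x) (J y) ;
  reg_contr : forall x, `|J x| <= `|x| ;
  reg_bound : exists M, forall x, `|K x| <= M * `|x| ;
  reg_coercive : forall x, C * `|J x| ^+ 2 <= `|K x| ^+ 2 }.

(** An everywhere defined symmetric map is automatically additive, which is why [regularizer] has no
    linearity field. *)
Lemma sym_subr (J : H -> H) : (forall x y, dot (J x) y = dot x (J y)) ->
  forall x y, J (x - y) = J x - J y.
Proof.
by move=> sJ x y; apply: (dot_eq hdot) => v; rewrite dotBl !sJ dotBl.
Qed.

(** Squaring the resolvent puts [J n x] in the domain of [A], where coercivity is available, and
    there [dot (A y) y = |B y|^2]. Convergence holds on the domain of [B], where
    [x - J1 n x = G n (B x)] has norm at most [|B x| / l n], and extends to [H] by density and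
    contractivity. *)
Lemma regularizers (A : linear_operator H) (C : R) :
  is_square_of A B ->
  (forall x, op_dom A x -> C * `|x| ^+ 2 <= dot (A x) x) ->
  exists J K : nat -> H -> H, (forall n, regularizer C (J n) (K n)) /\
    forall x, J n x @[n --> \oo] --> x.
Proof.
move=> [dA eA] coer.
have /choice[G hG] : forall n : nat, exists G : H -> H, forall x,
    op_dom B (G x) /\ B (G x) + n.+1%:R *: G x = x.
  move=> n; have l0 : 0 < (n.+1%:R : R) by rewrite ltr0n.
  have hG x : exists y, op_dom B y /\ B y + n.+1%:R *: y = x.
    by have [y ? ?] := resolvent_exists l0 x; exists y.
  by have [G' hG'] := choice hG; exists G'.
pose l (n : nat) : R := n.+1%:R.
have l0 n : 0 < l n by rewrite ltr0n.
have GD n x : op_dom B (G n x) by have [] := hG n x.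
have BG n x : B (G n x) = x - l n *: G n x.
  by have [_ {2}<-] := hG n x; rewrite addrK.
have Gsym n x y : dot (G n x) y = dot x (G n y).
  have [_ {1}<-] := hG n y; have [_ {2}<-] := hG n x.
  by rewrite dotDl dotDr dotZl dotZr self_adjoint_sym.
have Gn n x : l n * `|G n x| <= `|x|.
  by have [_ {2}<-] := hG n x; exact: resolvent_bound.
pose J1 n x := l n *: G n x.
have J1D n x : op_dom B (J1 n x) by exact: op_domZ.
have J1s n x y : dot (J1 n x) y = dot x (J1 n y) by rewrite dotZl dotZr Gsym.
have J1n n x : `|J1 n x| <= `|x| by rewrite normrZ gtr0_norm.
have BJ1 n x : B (J1 n x) = l n *: (x - J1 n x) by rewrite op_funZ// BG.
pose J n x := J1 n (J1 n x).
pose K n x := l n *: (J1 n x - J n x).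
have sJ n x y : dot (J n x) y = dot x (J n y) by rewrite /J !J1s.
have BJ n x : B (J n x) = K n x by rewrite /J BJ1.
have sK n x y : dot (K n x) y = dot x (K n y).
  by rewrite /K dotZl dotZr dotBl dotBr J1s sJ.
have JD n x : op_dom B (J n x) by exact: J1D.
have J1J n x : `|J n x| <= `|x| by apply: le_trans (J1n _ _) (J1n _ _).
exists J, K; split => [n|x].
  split=> //.
  - move=> x xD; apply: (dot_eq hdot) => v.
    by rewrite sK sJ -BJ self_adjoint_sym.
  - by move=> x y; rewrite -!BJ self_adjoint_sym.
  - exists (l n * 2) => x; rewrite /K normrZ gtr0_norm// -mulrA ler_pM2l//.
    apply: le_trans (ler_normB _ _) _.
    have := J1n n x; have := J1J n x; lra.
  - move=> x.
    have JA : op_dom A (J n x).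
      by apply/dA; split => //; rewrite BJ; apply: op_domZ; apply: op_domB.
    apply: le_trans (coer _ JA) _.
    by rewrite eA// BJ self_adjoint_sym//; [rewrite BJ hdot|rewrite -BJ;
      have [] := (dA (J n x)).1 JA].
have J1c : J1 n x @[n --> \oo] --> x.
  apply/cvgrPdist_lt => e e0.
  have e4 : 0 < e / 4 by rewrite divr_gt0.
  have [dD _] := hB.
  have [x' []] : (ball x (e / 4) `&` op_dom B) !=set0.
    apply: dD; last exact: ball_open.
    by exists x; exact: ballxx.
  rewrite -ball_normE /= => xx' x'D.
  have J1x' n : `|x' - J1 n x'| <= `|B x'| / l n.
    rewrite -BG ler_pdivlMr// mulrC.
    have -> : B (G n x') = G n (B x').
      apply: (dot_eq hdot) => v; rewrite BG [RHS]Gsym [RHS]self_adjoint_sym// BG.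
      by rewrite dotBl dotBr dotZl dotZr Gsym.
    exact: Gn.
  have B1 : 0 < `|B x'| + 1 by rewrite ltr_wpDl.
  have e5 : 0 < e / 4 / (`|B x'| + 1) by rewrite divr_gt0.
  have := @cvg_harmonic R => /cvgrPdist_lt/(_ _ e5); apply: filterS => n.
  rewrite sub0r normrN ger0_norm ?invr_ge0// ltr_pdivlMr// => hn.
  have hx : `|x' - J1 n x'| <= e / 4.
    apply: le_trans (J1x' n) _; apply: ltW; apply: le_lt_trans hn.
    by rewrite mulrC ler_pM2l ?invr_gt0// lerDl.
  have -> : x - J1 n x = (x - x') + (x' - J1 n x') - (J1 n (x - x')).
    by rewrite (sym_subr (J1s n)) [x - x' + _]addrA subrK opprB [RHS]addrA subrK.
  have := ler_normB ((x - x') + (x' - J1 n x')) (J1 n (x - x')).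
  have := ler_normD (x - x') (x' - J1 n x').
  have := J1n n (x - x'); lra.
apply/cvgrPdist_lt => e e0.
have e2 : 0 < e / 2 by rewrite divr_gt0.
move/cvgrPdist_lt: J1c => /(_ _ e2); apply: filterS => n hn.
have -> : x - J n x = (x - J1 n x) + J1 n (x - J1 n x).
  by rewrite (sym_subr (J1s n)) addrA subrK.
have := ler_normD (x - J1 n x) (J1 n (x - J1 n x)).
have := J1n n (x - J1 n x); lra.
Qed.

End Regularization.

(** * Weakly differentiable curves *)

Section WeakDerivatives.
Context {R : realType} {H : completeNormedModType R}.
Notation mu := (@lebesgue_measure R).
Variable dot : {dot H for @idfun R}.
Hypothesis hdot : hilbert_norm dot.

(** Polarization reduces joint continuity to that of the norm. *)
Lemma cvg_dot {T} {F : set_system T} {FF : Filter F} (a b : T -> H) la lb :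
  a @ F --> la -> b @ F --> lb -> dot (a t) (b t) @[t --> F] --> dot la lb.
Proof.
move=> ca cb.
have -> : (fun s => dot (a s) (b s)) =
    (fun s => 2^-1 * (`|a s| ^+ 2 + `|b s| ^+ 2 - `|a s - b s| ^+ 2)).
  by apply/funext => s; rewrite (normB2 hdot); field.
have -> : dot la lb = 2^-1 * (`|la| ^+ 2 + `|lb| ^+ 2 - `|la - lb| ^+ 2).
  by rewrite (normB2 hdot); field.
have sq (c : T -> H) lc : c @ F --> lc -> `|c s| ^+ 2 @[s --> F] --> `|lc| ^+ 2.
  move=> cc; rewrite expr2; under eq_fun do rewrite expr2.
  by apply: cvgM; exact: cvg_norm.
apply: cvgM; first exact: cvg_cst.
apply: cvgB; first by apply: cvgD; apply: sq.
by apply: (sq (fun s => a s - b s)); exact: cvgB.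
Qed.

Lemma continuous_dot (a b : R -> H) : continuous a -> continuous b ->
  continuous (fun s : R => dot (a s) (b s)).
Proof. by move=> ca cb t; apply: cvg_dot; [exact: ca|exact: cb]. Qed.

Lemma continuous_bounded_operator (J : H -> H) (M : R) (a : R -> H) :
  (forall x y, J (x - y) = J x - J y) -> (forall x, `|J x| <= M * `|x|) ->
  continuous a -> continuous (fun s : R => J (a s)).
Proof.
move=> Jl JM ca t; apply/cvgrPdist_lt => e e0.
have M1 : 0 < `|M| + 1 by rewrite ltr_wpDl.
have e1 : 0 < e / (`|M| + 1) by rewrite divr_gt0.
have := ca t => /cvgrPdist_lt/(_ _ e1); apply: filterS => s.
rewrite -Jl ltr_pdivlMr// => h; apply: le_lt_trans (JM _) _; apply: le_lt_trans h.
by rewrite mulrC ler_wpM2l//; have := ler_norm M; lra.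
Qed.

Lemma norm_bounded_on_segment (a : R -> H) (T : R) : continuous a ->
  exists2 M : R, 0 <= M & forall s : R, 0 <= s <= T -> `|a s| <= M.
Proof.
move=> ca; have [|M M0 hM] := @bounded_on_segment R (fun s => `|a s|) 0 T.
  by move=> t; apply: cvg_norm; exact: ca.
by exists M => // s hs; have := hM s hs; rewrite normr_id.
Qed.

(** The derivative is taken against fixed vectors, as for [u'] in the weak equation. The bound on
    [da], uniform down to time 0, makes [a] strongly locally Lipschitz. *)
Definition weakly_C1 (a da : R -> H) :=
  (forall w (t : R), 0 < t -> is_derive t 1 (fun s => dot (a s) w) (dot (da t) w)) /\
  (forall T, exists M, forall s, 0 < s < T -> `|da s| <= M).

Lemma weakly_C1_lipschitz (a da : R -> H) (t : R) : weakly_C1 a da -> 0 < t ->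
  exists2 M, 0 <= M & \forall s \near t, `|a s - a t| <= M * `|s - t|.
Proof.
move=> [dera bnd] t0; have [M0 hM0] := bnd (t + 1).
pose M := Num.max M0 0; have M_ge0 : 0 <= M by rewrite le_max lexx orbT.
have hM s : 0 < s < t + 1 -> `|da s| <= M.
  by move=> /hM0 h; rewrite le_max h.
exists M => //; near=> s.
have s1 : t / 2 < s by near: s; apply: near_gt; lra.
have s2 : s < t + 2^-1 by near: s; apply: near_lt; lra.
apply: (norm_le_dot hdot); first exact: mulr_ge0.
move=> v; apply: le_trans (ler_norm _) _; rewrite dotBl.
have -> : M * `|s - t| * `|v| = M * `|v| * `|s - t| by ring.
apply: (@lipschitz_of_derive R (fun x => dot (a x) v) (fun x => dot (da x) v) (t / 2) (t + 2^-1)).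
- by move=> x /andP[x0 x1]; apply: dera; lra.
- move=> x /andP[x0 x1]; apply: le_trans (dot_le_norm hdot _ _) _.
  by apply: ler_wpM2r => //; apply: hM; apply/andP; split; lra.
- move=> x /andP[x0 x1]; have x0' : 0 < x by lra.
  exact: is_derive_cts (dera v x x0').
- by apply/andP; split; lra.
- by apply/andP; split; lra.
Unshelve. all: by end_near. Qed.

(** With one factor frozen, weak differentiability applies; the product of the two increments is
    quadratic in [s - t] by the Lipschitz bounds. Thus no strong derivative is needed. *)
Lemma weakly_C1_dot (a da b db : R -> H) (t : R) : weakly_C1 a da -> weakly_C1 b db -> 0 < t ->
  is_derive t 1 (fun s => dot (a s) (b s)) (dot (da t) (b t) + dot (a t) (db t)).
Proof.
move=> ha hb t0.
have [Ma Ma0 la] := weakly_C1_lipschitz ha t0.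
have [Mb Mb0 lb] := weakly_C1_lipschitz hb t0.
pose rem s := dot (a s - a t) (b s - b t).
have drem : is_derive t 1 rem 0.
  apply/is_derive_near => e e0.
  have M1 : 0 < Ma * Mb + 1 by have := mulr_ge0 Ma0 Mb0; lra.
  have e1 : 0 < e / (Ma * Mb + 1) by rewrite divr_gt0.
  near=> s; rewrite /rem subrr dot0l subr0 mul0r subr0.
  apply: le_trans (dot_le_norm hdot _ _) _.
  have h1 : `|a s - a t| <= Ma * `|s - t| by near: s.
  have h2 : `|b s - b t| <= Mb * `|s - t| by near: s.
  apply: le_trans (ler_pM _ _ h1 h2) _ => //.
  have : `|t - s| < e / (Ma * Mb + 1).
    by near: s; apply/nbhs_ballP; exists (e / (Ma * Mb + 1)) => //= s; rewrite -ball_normE.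
  rewrite ltr_pdivlMr// distrC => h3.
  have -> : Ma * `|s - t| * (Mb * `|s - t|) = (Ma * Mb * `|s - t|) * `|s - t| by ring.
  by rewrite ler_wpM2r//; have := normr_ge0 (s - t); lra.
have -> : (fun s => dot (a s) (b s)) =
    (fun s => (dot (a s) (b t) + dot (b s) (a t)) + (rem s - dot (a t) (b t))).
  apply/funext => s; rewrite /rem dotBl !dotBr (dotC dot (b s) (a t)); ring.
have d1 := is_derive_add (ha.1 (b t) t t0) (hb.1 (a t) t t0).
have d2 := is_derive_sub drem (is_derive_cst (dot (a t) (b t)) t 1).
apply: is_derive_eq_val (is_derive_add d1 d2) _.
by rewrite (dotC dot (db t)); ring.
Unshelve. all: by end_near. Qed.

Lemma weakly_C1_sub (a da b db : R -> H) : weakly_C1 a da -> weakly_C1 b db ->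
  weakly_C1 (fun s => a s - b s) (fun s => da s - db s).
Proof.
move=> [ha Ma] [hb Mb]; split.
  move=> w t t0; rewrite dotBl.
  under eq_fun do rewrite dotBl.
  by apply: is_derive_sub; [exact: ha|exact: hb].
move=> T; have [M hM] := Ma T; have [N hN] := Mb T; exists (M + N) => s hs.
by apply: le_trans (ler_normB _ _) _; apply: lerD; [exact: hM|exact: hN].
Qed.

Lemma weakly_C1_sym (J : H -> H) (M : R) (a da : R -> H) :
  (forall x y, dot (J x) y = dot x (J y)) -> (forall x, `|J x| <= M * `|x|) ->
  weakly_C1 a da -> weakly_C1 (fun s => J (a s)) (fun s => J (da s)).
Proof.
move=> sJ JM [ha Ma]; split.
  by move=> w t t0; rewrite sJ; under eq_fun do rewrite sJ; exact: ha.
move=> T; have [N hN] := Ma T; exists (`|M| * N) => s hs.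
apply: le_trans (JM _) _; apply: (@le_trans _ _ (`|M| * `|da s|)).
  by rewrite ler_wpM2r// ler_norm.
by rewrite ler_wpM2l// hN.
Qed.

Variable k : R -> R.
Hypotheses (ck : continuous k).

Lemma convD (g h : R -> R) (t : R) : continuous g -> continuous h ->
  conv k (fun s => g s + h s) t = conv k g t + conv k h t.
Proof.
move=> cg ch; rewrite /conv -RintegralD//.
- by apply: eq_Rintegral => s _; rewrite mulrDr.
- by apply: continuous_integrable; apply: continuousM_fun => //; exact: continuous_comp_sub.
- by apply: continuous_integrable; apply: continuousM_fun => //; exact: continuous_comp_sub.
Qed.

Lemma convZ (c : R) (g : R -> R) (t : R) : continuous g ->
  conv k (fun s => c * g s) t = c * conv k g t.
Proof.
move=> cg; rewrite /conv -RintegralZl//.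
- by apply: eq_Rintegral => s _; rewrite mulrCA.
- by apply: continuous_integrable; apply: continuousM_fun => //; exact: continuous_comp_sub.
Qed.

Lemma conv_cst (c t : R) : 0 <= t -> conv k (fun=> c) t = c * \int[mu]_(r in `[0, t]) k r.
Proof.
move=> t0; rewrite convE//; last exact: cst_continuous.
rewrite -RintegralZl//; last exact: continuous_integrable.
by apply: eq_Rintegral => s _; rewrite mulrC.
Qed.

Hypothesis k_ge0 : forall t, 0 <= k t.

Lemma conv_le (g h : R -> R) (t : R) : continuous g -> continuous h ->
  (forall s : R, 0 <= s <= t -> g s <= h s) -> conv k g t <= conv k h t.
Proof.
move=> cg ch gh; apply: le_Rintegral => //.
- by apply: continuous_integrable; apply: continuousM_fun => //; exact: continuous_comp_sub.
- by apply: continuous_integrable; apply: continuousM_fun => //; exact: continuous_comp_sub.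
- by move=> s /=; rewrite in_itv /= => hs; rewrite ler_wpM2l// gh.
Qed.

Lemma conv_ge0 (g : R -> R) (t : R) : (forall s : R, 0 <= s <= t -> 0 <= g s) -> 0 <= conv k g t.
Proof.
move=> g0; apply: Rintegral_ge0 => s /=; rewrite in_itv /= => hs.
by rewrite mulr_ge0// g0.
Qed.

Lemma conv_bound (g : R -> R) (T Mk M : R) : continuous g ->
  (forall s : R, 0 <= s <= T -> `|k s| <= Mk) ->
  (forall s : R, 0 <= s <= T -> `|g s| <= M) ->
  forall t, 0 <= t <= T -> `|conv k g t| <= Mk * M * t.
Proof.
move=> cg hk hg t /andP[t0 tT]; apply: integral_norm_le => //.
  by apply: continuousM_fun => //; exact: continuous_comp_sub.
move=> s /andP[s0 st]; rewrite normrM ler_pM//.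
  by apply: hk; apply/andP; split; lra.
by apply: hg; apply/andP; split; lra.
Qed.

Lemma conv_cvg0 (g : R -> R) : continuous g -> conv k g t @[t --> (0 : R)] --> (0 : R).
Proof.
move=> cg; apply/cvgrPdist_le => e e0.
have [Mk Mk0 hk] := bounded_on_segment 0 1 ck.
have [Mg Mg0 hg] := bounded_on_segment 0 1 cg.
have M1 : 0 < Mk * Mg + 1 by have := mulr_ge0 Mk0 Mg0; lra.
near=> s; rewrite sub0r normrN.
have [s0|s0] := leP s 0; first by rewrite /conv integral_segment0// normr0 ltW.
have s1 : s <= 1 by apply/ltW; near: s; apply: near_lt; exact: ltr01.
apply: le_trans (conv_bound cg hk hg _) _; first by rewrite (ltW s0).
have : s <= e / (Mk * Mg + 1).
  by apply/ltW; near: s; apply: near_lt; rewrite divr_gt0.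
rewrite ler_pdivlMr//; lra.
Unshelve. all: by end_near. Qed.

(** The convolution of [k] with [g] is the Riesz representative of [w |-> conv k (dot (g s) w) t].
    The norm of this functional is of order [t] on bounded time intervals, which gives the local
    bound and the limit at 0. *)
Lemma vector_conv (g : R -> H) : continuous g ->
  exists z : R -> H, [/\ (forall t w, dot (z t) w = conv k (fun s => dot (g s) w) t),
    (forall T, exists M, forall s, 0 < s < T -> `|z s| <= M) &
    z t @[t --> (0 : R)] --> (0 : H)].
Proof.
move=> cg.
have cgw w : continuous (fun s : R => dot (g s) w).
  by apply: continuous_dot => //; exact: cst_continuous.
have est T : exists2 M, 0 <= M & forall t w, 0 <= t <= T ->
    `|conv k (fun s => dot (g s) w) t| <= M * t * `|w|.
  have [Mk Mk0 hk] := bounded_on_segment 0 T ck.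
  have [Mg Mg0 hg] := norm_bounded_on_segment T cg.
  exists (Mk * Mg); first exact: mulr_ge0.
  move=> t w ht; have -> : Mk * Mg * t * `|w| = Mk * (Mg * `|w|) * t by ring.
  apply: conv_bound ht => // s hs.
  by apply: le_trans (dot_le_norm hdot _ _) _; apply: ler_wpM2r => //; exact: hg.
have /choice[z hz] t : exists z, forall w, dot z w = conv k (fun s => dot (g s) w) t.
  have [t0|t0] := leP t 0.
    by exists 0 => w; rewrite dot0l /conv integral_segment0.
  have [M _ hM] := est t.
  have [|w|z hz] := @riesz_representation R H dot hdot (fun w => conv k (fun s => dot (g s) w)
    t) (M * t).
  - move=> a y w; rewrite -convZ// -convD//.
      by congr conv; apply/funext => s; rewrite dotDr dotZr.
    by apply: continuousM_fun => //; exact: cst_continuous.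
  - by apply: hM; rewrite lexx ltW.
  - by exists z => w; rewrite -hz.
have zb T : exists2 M, 0 <= M & forall t, 0 <= t <= T -> `|z t| <= M * t.
  have [M M0 hM] := est T; exists M => // t ht.
  apply: (norm_le_dot hdot); first by apply: mulr_ge0 => //; case/andP: ht.
  by move=> w; apply: le_trans (ler_norm _) _; rewrite hz; exact: hM.
exists z; split => //.
  move=> T; have [M M0 hM] := zb T; exists (M * T) => s /andP[s0 sT].
  apply: le_trans (hM s _) _; first by rewrite !ltW.
  by rewrite ler_wpM2l// ltW.
have [M M0 hM] := zb 1.
have M1 : 0 < M + 1 by lra.
apply/cvgrPdist_le => e e0; near=> s; rewrite sub0r normrN.
have [s0|s0] := leP s 0.
  have -> : z s = 0.
    by apply: (dot_eq hdot) => w; rewrite dot0l hz /conv integral_segment0.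
  by rewrite normr0 ltW.
have s1 : s <= 1 by apply/ltW; near: s; apply: near_lt; exact: ltr01.
apply: le_trans (hM _ _) _; first by rewrite (ltW s0).
have : s <= e / (M + 1).
  by apply/ltW; near: s; apply: near_lt; rewrite divr_gt0.
rewrite ler_pdivlMr//; lra.
Unshelve. all: by end_near. Qed.

Lemma weakly_C1_conv (g dg z dz : R -> H) : continuous g -> continuous dg -> weakly_C1 g dg ->
  (forall t w, dot (z t) w = conv k (fun s => dot (g s) w) t) ->
  (forall t w, dot (dz t) w = conv k (fun s => dot (dg s) w) t) ->
  (forall T, exists M, forall s, 0 < s < T -> `|dz s| <= M) ->
  weakly_C1 z (fun t => k t *: g 0 + dz t).
Proof.
move=> cg cdg [hg _] hz hdz bz; split.
  move=> w t t0; rewrite dotDl dotZl hdz.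
  have -> : (fun s => dot (z s) w) = conv k (fun s => dot (g s) w).
    by apply/funext => s; rewrite hz.
  apply: (@is_derive_conv R k (fun s => dot (g s) w) (fun s => dot (dg s) w)) => //.
  - by apply: continuous_dot => //; exact: cst_continuous.
  - by apply: continuous_dot => //; exact: cst_continuous.
move=> T; have [M hM] := bz T.
have [Mk _ hk] := bounded_on_segment 0 T ck.
exists (Mk * `|g 0| + M) => s /andP[s0 sT].
apply: le_trans (ler_normD _ _) _; apply: lerD; last by apply: hM; rewrite s0.
by rewrite normrZ ler_wpM2r// hk// !ltW.
Qed.

End WeakDerivatives.

(** * Lyapunov inequalities *)

Section Lyapunov.
Context {R : realType}.

Definition decay_time (k0 C eta : R) : R := (k0 + 2) / C + 1 + 3 / eta.

Lemma decay_time_gt0 (k0 C eta : R) : 0 < k0 -> 0 < C -> 0 < eta -> 0 < decay_time k0 C eta.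
Proof.
move=> k00 C0 e0; rewrite /decay_time.
have h1 : 0 < (k0 + 2) / C by rewrite divr_gt0//; lra.
have h2 : 0 < 3 / eta by rewrite divr_gt0//; lra.
lra.
Qed.

(** In the application [w2 = |u'|^2], [P2 = |B p|^2], [m = <u', q'>] for the regularized solution,
    and [N2] is twice the non-kinetic energy. The kinetic terms cancel, leaving
    [3 / 2 * N2 + k0 / C * D], hence [3 / eta + k0 / C] times [D]; [eps] turns this into at most
    [2 / 3 * D]. *)
Lemma lyapunov_dissipation (k0 C eta D P2 w2 m N2 : R) : 0 < k0 -> 0 < C -> 0 < eta ->
  0 <= N2 -> eta * N2 <= 2 * D -> P2 <= N2 -> m <= 2^-1 * w2 + k0 / C * D ->
  let eps := 2 / (3 * decay_time k0 C eta) in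
  - D + eps * (P2 + m - w2) <= - eps * (2^-1 * (w2 + N2)).
Proof.
move=> k00 C0 e0 N0 h1 h2 h3 /=.
have T0 := decay_time_gt0 k00 C0 e0.
set eps := 2 / _.
have eps0 : 0 < eps by rewrite divr_gt0//; lra.
have epsT : eps * decay_time k0 C eta = 2 / 3 by rewrite /eps; field; lra.
have D0 : 0 <= D by have := mulr_ge0 (ltW e0) N0; lra.
have hN : N2 <= 2 / eta * D.
  by rewrite mulrAC ler_pdivlMr// mulrC.
have h4 : P2 + m - w2 + 2^-1 * (w2 + N2) <= (3 / eta + k0 / C) * D.
  have -> : (3 / eta + k0 / C) * D = 3 / 2 * (2 / eta * D) + k0 / C * D by field; lra.
  lra.
have h5 : eps * ((3 / eta + k0 / C) * D) <= 2 / 3 * D.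
  rewrite mulrA ler_wpM2r// -epsT ler_pM2l// /decay_time.
  have : 0 < 2 / C by rewrite divr_gt0.
  by rewrite mulrDl; lra.
have := ler_wpM2l (ltW eps0) h4; lra.
Qed.

(** [X] is plus or minus the cross term [<u', p>] and [p2 = |p|^2]; the bound is one third of the
    energy, whence the factors [2 / 3] and [4 / 3]. The part [1 + 2 / C] of [decay_time] is used
    here. *)
Lemma lyapunov_perturbation (k0 C eta p2 w2 X N2 : R) : 0 < k0 -> 0 < C -> 0 < eta ->
  0 <= p2 -> 0 <= w2 -> C * p2 <= N2 ->
  (forall th, 0 < th -> X <= 2^-1 * (th * w2 + p2 / th)) ->
  2 / (3 * decay_time k0 C eta) * X <= 6^-1 * (w2 + N2).
Proof.
move=> k00 C0 e0 p0 w0 hp hX.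
have T0 := decay_time_gt0 k00 C0 e0.
pose T := decay_time k0 C eta; rewrite -/T in T0 *.
have TC : 1 + 2 / C <= T.
  rewrite /T /decay_time mulrDl.
  have h1 : 0 < k0 / C by rewrite divr_gt0.
  have h2 : 0 < 3 / eta by rewrite divr_gt0.
  lra.
(* AM-GM with weight [T / 2]; then [4 / C <= (1 + 2 / C) ^ 2 <= T ^ 2]. *)
have := hX (T / 2); rewrite divr_gt0// => /(_ isT) {}hX.
have p2T : p2 / (T / 2) <= T / 2 * N2.
  have N0 : p2 <= N2 / C by rewrite ler_pdivlMr// mulrC.
  have N20 : 0 <= N2 by apply: le_trans hp; rewrite mulr_ge0// ltW.
  have CT : 4 / C <= T ^+ 2.
    have i0 : 0 < 2 / C by rewrite divr_gt0.
    have -> : 4 / C = 2 * (2 / C) by field; lra.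
    nra.
  rewrite ler_pdivrMr ?divr_gt0//.
  apply: le_trans N0 _.
  have -> : N2 / C = 4^-1 * (4 / C * N2) by field; lra.
  have := ler_wpM2r N20 CT; lra.
have -> : 6^-1 * (w2 + N2) = 2 / (3 * T) * (2^-1 * (T / 2 * w2 + T / 2 * N2)) by field; lra.
by rewrite ler_pM2l; [lra|rewrite divr_gt0//; lra].
Qed.

Lemma derive_nonincreasing (G dG : R -> R) (a b : R) : a <= b ->
  (forall x, a < x < b -> is_derive x 1 G (dG x)) ->
  (forall x, a < x < b -> dG x <= 0) ->
  (forall x, a <= x <= b -> {for x, continuous G}) -> G b <= G a.
Proof.
move=> ab dGP dG0 cG; apply: (@ler0_derive1_le_cc R G a b) => //.
- by move=> x; rewrite in_itv /= => hx; have [] := dGP x hx.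
- by move=> x; rewrite in_itv /= => hx; have [_ h] := dGP x hx; rewrite derive1E h dG0.
- apply: continuous_in_subspaceT => x; rewrite inE /= in_itv /=; exact: cG.
- by rewrite in_itv /= ab lexx.
- by rewrite in_itv /= lexx ab.
Qed.

Lemma gronwall_decay (L dL : R -> R) (al T : R) : 0 <= T ->
  (forall x, 0 < x < T -> is_derive x 1 L (dL x)) ->
  (forall x, 0 < x < T -> dL x <= - al * L x) ->
  (forall x, 0 <= x <= T -> {for x, continuous L}) ->
  L T <= L 0 * expR (- (al * T)).
Proof.
move=> T0 dLP dL0 cL.
have dE (x : R) : is_derive x 1 (fun y => expR (al * y)) (al * expR (al * x)).
  have := @is_derive1_comp R expR (fun y => al * y) x (expR (al * x)) al (is_derive_expR _).
  rewrite mulrC; apply.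
  by have := is_derive_scale al (@is_derive_id R R x 1); rewrite mulr1.
have := @derive_nonincreasing (fun x => L x * expR (al * x))
  (fun x => dL x * expR (al * x) + L x * (al * expR (al * x))) 0 T T0.
rewrite mulr0 expR0 mulr1 => h.
rewrite expRN -ler_pdivrMr ?invr_gt0 ?expR_gt0// invrK; apply: h.
- by move=> x hx; apply: is_derive_mul => //; exact: dLP.
- move=> x hx; have -> : dL x * expR (al * x) + L x * (al * expR (al * x)) =
     (dL x + al * L x) * expR (al * x) by ring.
  rewrite pmulr_lle0 ?expR_gt0//; have := dL0 x hx; lra.
- move=> x hx; apply: cvgM; first exact: cL.
  exact: is_derive_cts (dE x).
Qed.

End Lyapunov.

(** * Decay of the regularized energy *)

Section RegularizedEnergy.
Context {R : realType} {H : completeNormedModType R}.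
Notation mu := (@lebesgue_measure R).
Variables (dot : {dot H for @idfun R}) (B : linear_operator H) (C eta : R)
  (J K : H -> H) (k : R -> R) (u v b : R -> H).
Hypotheses (hdot : hilbert_norm dot) (reg : regularizer dot B C J K)
  (C0 : 0 < C) (eta0 : 0 < eta) (ck : continuous k)
  (kac : locally_absolutely_continuous k)
  (kdecay : {ae mu, forall x : R, 0 < x -> derivable k x 1 /\ derive1 k x <= - eta * k x})
  (k_ge0 : forall t, 0 <= k t) (k00 : 0 < k 0)
  (kint : (\int[mu]_(t in `[0%R, +oo[) (k t)%:E = 1)%E)
  (cu : continuous u) (cv : continuous v) (cb : continuous b)
  (bE : forall t, op_dom B (u t) /\ b t = B (u t))
  (uv : weakly_C1 dot u v)
  (eqn : forall w, op_dom B w -> forall t : R, 0 < t ->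
    is_derive t 1 (fun s => dot (v s) w)
      (conv k (fun s => dot (b s) (B w)) t - dot (b t) (B w))).

(** The energy of [J u]: here [v] is [u'], [b] is [B u], and [K = B J], so [J v] is the velocity of
    [J u] and [K u] its image under [B]. *)
Definition regularized_energy (t : R) : R :=
  2^-1 * `|J (v t)| ^+ 2
  + 2^-1 * (1 - \int[mu]_(s in `[0, t]) k s) * `|K (u t)| ^+ 2
  + 2^-1 * conv k (fun s => `|K (u s) - K (u t)| ^+ 2) t.

Let Jsub := sym_subr hdot (reg_sym reg).
Let Ksub := sym_subr hdot (reg_op_sym reg).

Let Jbd x : `|J x| <= 1 * `|x|.
Proof. by rewrite mul1r; exact: reg_contr reg x. Qed.

(** Gronwall applies to [L]; the factor 2 is [3 / 2 * (4 / 3)], from comparing [L] with the energy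
    at [T] and at 0. *)
Lemma regularized_energy_decay (T : R) : 0 <= T ->
  regularized_energy T <=
  2 * regularized_energy 0 * expR (- ((2 * decay_time (k 0) C eta)^-1 * T)).
Proof.
move=> T0; have [MK Kbd] := reg_bound reg.
have cJ (a : R -> H) : continuous a -> continuous (fun s : R => J (a s)).
  exact: continuous_bounded_operator Jsub Jbd.
have cK (a : R -> H) : continuous a -> continuous (fun s : R => K (a s)).
  exact: continuous_bounded_operator Ksub Kbd.
have cdot := continuous_dot hdot.
have [zu [zuE zub zu0]] := vector_conv hdot ck cu.
have [zv [zvE zvb _]] := vector_conv hdot ck cv.
have [zb [zbE zbb _]] := vector_conv hdot ck cb.
have w_zu : weakly_C1 dot zu (fun t => k t *: u 0 + zv t).
  by apply: (weakly_C1_conv hdot ck cu cv uv zuE zvE); exact: zvb.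
(* [f = B J u] and [W = (J u)']; below, [y] is the [p] of the overview, [dy] its derivative, and [q]
   plays the part of [B p]. *)
pose f t := K (u t); pose df t := K (v t); pose W t := J (v t).
pose q t := zb t - b t; pose y t := zu t - u t.
pose dy t := k t *: u 0 + zv t - v t.
have w_y : weakly_C1 dot y dy by exact: weakly_C1_sub.
have w_f : weakly_C1 dot f df by exact: weakly_C1_sym (reg_op_sym reg) Kbd uv.
(* The regularized equation: [J w] is an admissible test vector and [B (J w) = K w], so the
   right-hand side involves only bounded operators. *)
have w_W : weakly_C1 dot W (fun t => K (q t)).
  split.
    move=> w t t0; rewrite (reg_op_sym reg) /q dotBl zbE -(reg_opE reg).
    under eq_fun do rewrite (reg_sym reg).
    exact: eqn (reg_dom reg w) _ t0.
  move=> S; have [M hM] := zbb S; have [N _ hN] := norm_bounded_on_segment S cb.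
  exists (`|MK| * (M + N)) => s hs; apply: le_trans (Kbd _) _.
  apply: (@le_trans _ _ (`|MK| * `|q s|)); first by rewrite ler_wpM2r// ler_norm.
  rewrite ler_wpM2l//; apply: le_trans (ler_normB _ _) _; apply: lerD; first exact: hM.
  by apply: hN; case/andP: hs => ? ?; rewrite !ltW.
have w_Jy : weakly_C1 dot (fun t => J (y t)) (fun t => J (dy t)).
  exact: weakly_C1_sym (reg_sym reg) Jbd w_y.
have w_Kzu : weakly_C1 dot (fun t => K (zu t)) (fun t => K (k t *: u 0 + zv t)).
  exact: weakly_C1_sym (reg_op_sym reg) Kbd w_zu.
have w_ff := weakly_C1_dot hdot w_f w_f.
have cf : continuous f by exact: cK.
have cdf : continuous df by exact: cK.
have cW : continuous W by exact: cJ.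
have cst (z : H) : continuous (fun _ : R => z) by exact: cst_continuous.
have cstR (z : R) : continuous (fun _ : R => z) by exact: cst_continuous.
have cmul (c : R) (g : R -> R) : continuous g -> continuous (fun s : R => c * g s).
  by move=> cg; apply: continuousM_fun.
have cadd (g h : R -> R) : continuous g -> continuous h -> continuous (fun s : R => g s + h s).
  by move=> cg ch x; apply: cvgD; [exact: cg|exact: ch].
have Kf w t : dot (K (zu t)) w = conv k (fun s => dot (f s) w) t.
  rewrite (reg_op_sym reg) zuE; congr conv; apply/funext => s.
  by rewrite (reg_op_sym reg).
have Kdf w t : dot (K (k t *: u 0 + zv t)) w =
    k t * dot (f 0) w + conv k (fun s => dot (df s) w) t.
  rewrite (reg_op_sym reg) dotDl dotZl zvE (reg_op_sym reg); congr (_ + conv _ _ _).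
  by apply/funext => s; rewrite (reg_op_sym reg).
have Jdy w t : dot (J (dy t)) w =
    k t * dot (J (u 0)) w + conv k (fun s => dot (W s) w) t - dot (W t) w.
  rewrite (reg_sym reg) dotBl dotDl dotZl zvE !(reg_sym reg); congr (_ + conv _ _ _ - _).
  by apply/funext => s; rewrite (reg_sym reg).
pose P t := K (y t).
have PE t : P t = K (zu t) - f t by exact: Ksub.
(* The rigorous form of [q = B p]: tested against [w], the operators reach the values [u s], which
   lie in the domain of [B], where [J] and [B] commute. *)
have Jq t : J (q t) = P t.
  apply: (dot_eq hdot) => w; rewrite PE dotBl Kf (reg_sym reg) /q dotBl zbE.
  have Jb s : dot (b s) (J w) = dot (f s) w.
    have [uD ->] := bE s; rewrite /f (reg_comm reg uD).
    by rewrite (reg_sym reg).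
  by rewrite Jb; congr (conv _ _ _ - _); apply/funext => s.
(* Half of [|f s - f t|^2], expanded so that [conv k] acts termwise and [t] can be frozen when
   differentiating in [s]. *)
pose chi t s := 2^-1 * dot (f s) (f s) + (- 1) * dot (f s) (f t) + 2^-1 * dot (f t) (f t).
have chiE t s : chi t s = 2^-1 * `|f s - f t| ^+ 2.
  by rewrite /chi (normB2 hdot) !hdot; field.
have c_ff : continuous (fun s => dot (f s) (f s)) by exact: cdot.
have c_fw w : continuous (fun s => dot (f s) w) by exact: cdot _ _ cf (cst w).
have c_chi0 t : continuous (fun s => 2^-1 * dot (f s) (f s) + (- 1) * dot (f s) (f t)).
  exact: (cadd _ _ (cmul _ _ c_ff) (cmul _ _ (c_fw _))).
have c_chi t : continuous (chi t).
  exact: (cadd _ _ (c_chi0 t) (cstR _)).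
pose kap t := \int[mu]_(r in `[0, t]) k r.
pose cff t := conv k (fun s => dot (f s) (f s)) t.
have conv_chi t : 0 <= t -> conv k (chi t) t =
    2^-1 * cff t - dot (K (zu t)) (f t) + 2^-1 * dot (f t) (f t) * kap t.
  move=> t0; rewrite /chi (convD ck _ (c_chi0 t) (cstR _)).
  rewrite (convD ck _ (cmul _ _ c_ff) (cmul _ _ (c_fw _))) !convZ//.
  by rewrite conv_cst// Kf -/(cff t) -/(kap t) mulN1r mulrA.
pose N2 t := 2 * conv k (chi t) t + (1 - kap t) * dot (f t) (f t).
have kap1 t : kap t <= 1 by exact: integral_kernel_le1.
have N2_ge0 t : 0 <= t -> 0 <= N2 t.
  move=> t0; rewrite /N2 addr_ge0// mulr_ge0//.
  - by apply: conv_ge0 => // s _; rewrite chiE mulr_ge0// sqr_ge0.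
  - by rewrite subr_ge0.
  - exact: dot_ge0.
pose E t := 2^-1 * (dot (W t) (W t) + N2 t).
have energyE t : 0 <= t -> regularized_energy t = E t.
  move=> t0; rewrite /regularized_energy !hdot -/(W t) -/(f t) -/(kap t).
  have -> : conv k (fun s => `|K (u s) - f t| ^+ 2) t = 2 * conv k (chi t) t.
    by rewrite -(convZ ck _ _ (c_chi t)); congr conv; apply/funext => s;
      rewrite chiE mulrA divff// mul1r.
  by rewrite /E /N2; field.
pose eps := 2 / (3 * decay_time (k 0) C eta).
(* Expanding the square in the memory term makes the [kap] contributions cancel, so only
   convolutions and scalar products remain to be differentiated. *)
pose L t := 2^-1 * (dot (W t) (W t) + dot (f t) (f t) + cff t) - dot (K (zu t)) (f t)
   + eps * dot (W t) (J (y t)).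
have LE t : 0 <= t -> L t = E t + eps * dot (W t) (J (y t)).
  by move=> t0; rewrite /L /E /N2 conv_chi//; field.
(* [P t] averages [f s - f t] with weight [k (t - s)] and [- f t] with weight [1 - kap t], of total
   mass 1. Pairing with [P t] and applying AM-GM to each part gives [|P|^2 <= (N2 + |P|^2) / 2]. *)
have P_le t : 0 <= t -> dot (P t) (P t) <= N2 t.
  move=> t0.
  have e1 : dot (P t) (P t) = conv k (fun s => dot (f s) (P t) + (- dot (f t) (P t))) t
      - (1 - kap t) * dot (f t) (P t).
    rewrite (convD ck _ (c_fw _) (cstR _)).
    by rewrite conv_cst// -/(kap t) {1}PE dotBl Kf; ring.
  have h1 : conv k (fun s => dot (f s) (P t) + (- dot (f t) (P t))) t <=
      conv k (fun s => chi t s + 2^-1 * dot (P t) (P t)) t.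
    apply: conv_le => //; [exact: (cadd _ _ (c_fw _) (cstR _))|exact: (cadd _ _ (c_chi t) (cstR
      _))|move=> s _].
    by rewrite chiE -dotBl; have := dot_le_half hdot (f s - f t) (P t);
      rewrite [`|P t| ^+ 2]hdot; lra.
  rewrite (convD ck _ (c_chi t) (cstR _)) conv_cst// -/(kap t) in h1.
  have h2 : - dot (f t) (P t) <= 2^-1 * (dot (f t) (f t) + dot (P t) (P t)).
    by rewrite -dotNl; have := dot_le_half hdot (- f t) (P t); rewrite normrN !hdot.
  have k1 : 0 <= 1 - kap t by rewrite subr_ge0.
  have := ler_wpM2l k1 h2; rewrite /N2; lra.
have amgm a c th : 0 < th -> dot a c <= 2^-1 * (th * dot a a + dot c c / th).
  move=> th0; have := dot_ge0 hdot (th *: a - c).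
  rewrite dotBl !dotBr !dotZl !dotZr (dotC dot c a) => h.
  rewrite -(ler_pM2l th0); have -> : th * (2^-1 * (th * dot a a + dot c c / th)) =
     2^-1 * (th * (th * dot a a) + dot c c) by field; lra.
  lra.
have L_bounds t : 0 <= t -> 2 / 3 * E t <= L t <= 4 / 3 * E t.
  move=> t0; rewrite LE//.
  have pert X : (forall th, 0 < th ->
    X <= 2^-1 * (th * dot (W t) (W t) + dot (J (y t)) (J (y t)) / th)) ->
      eps * X <= 6^-1 * (dot (W t) (W t) + N2 t).
    move=> hX; apply: (lyapunov_perturbation (p2 := dot (J (y t)) (J (y t)))) => //;
      try exact: dot_ge0.
    by apply: le_trans (P_le t t0); rewrite -!hdot; exact: reg_coercive reg _.
  have h1 := pert (dot (W t) (J (y t))) (fun th th0 => amgm _ _ th th0).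
  have h2 := pert (- dot (W t) (J (y t))).
  have : eps * - dot (W t) (J (y t)) <= 6^-1 * (dot (W t) (W t) + N2 t).
    apply: h2 => th th0; have := amgm (- W t) (J (y t)) th th0.
    by rewrite !dotNl dotNr opprK.
  by move: h1; rewrite /E => h3 h4; apply/andP; split; lra.
pose dL t := 2^-1 * ((dot (K (q t)) (W t) + dot (W t) (K (q t)))
     + (dot (df t) (f t) + dot (f t) (df t))
     + (k t * dot (f 0) (f 0) + conv k (fun s => dot (df s) (f s) + dot (f s) (df s)) t))
   - (dot (K (k t *: u 0 + zv t)) (f t) + dot (K (zu t)) (df t))
   + eps * (dot (K (q t)) (J (y t)) + dot (W t) (J (dy t))).
have c_dff : continuous (fun s => dot (df s) (f s) + dot (f s) (df s)).
  exact: (cadd _ _ (cdot _ _ cdf cf) (cdot _ _ cf cdf)).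
have LP (t : R) : 0 < t -> is_derive t 1 L (dL t).
  move=> t0.
  have d1 := weakly_C1_dot hdot w_W w_W t0.
  have d2 := w_ff t t0.
  have d3 : is_derive t 1 cff _ := is_derive_conv ck (cdot _ _ cf cf) c_dff w_ff t0.
  have d4 := weakly_C1_dot hdot w_Kzu w_f t0.
  have d5 := weakly_C1_dot hdot w_W w_Jy t0.
  exact: is_derive_add (is_derive_sub (is_derive_scale 2^-1 (is_derive_add (is_derive_add d1 d2)
    d3)) d4) (is_derive_scale eps d5).
have TT0 := decay_time_gt0 k00 C0 eta0.
have w_U : weakly_C1 dot (fun t => J (u t)) W by exact: weakly_C1_sym (reg_sym reg) Jbd uv.
pose dchi t s := dot (df s) (f s) + (- 1) * dot (df s) (f t).
have c_dfw w : continuous (fun s => dot (df s) w) by exact: cdot _ _ cdf (cst w).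
have c_dchi t : continuous (dchi t) by exact: (cadd _ _ (cdot _ _ cdf cf) (cmul _ _ (c_dfw _))).
have chiP (t s : R) : 0 < s -> is_derive s 1 (chi t) (dchi t s).
  move=> s0; have d1 := is_derive_scale 2^-1 (w_ff s s0).
  have d2 := is_derive_scale (- 1) (w_f.1 (f t) s s0).
  have d3 := is_derive_cst (2^-1 * dot (f t) (f t)) s 1.
  apply: is_derive_eq_val (is_derive_add (is_derive_add d1 d2) d3) _.
  by rewrite /dchi (dotC dot (f s)); field.
have chi_tt t : chi t t = 0 by rewrite /chi; field.
pose cdff t := conv k (fun s => dot (df s) (f s)) t.
have conv_dchi t : conv k (dchi t) t = cdff t - conv k (fun s => dot (df s) (f t)) t.
  rewrite /dchi (convD ck _ (cdot _ _ cdf cf) (cmul _ _ (c_dfw _))) convZ//.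
  by rewrite mulN1r.
have dL_le t : 0 < t -> dL t <= - (2 * decay_time (k 0) C eta)^-1 * L t.
  move=> t0; have t0' := ltW t0.
  (* The dissipation with [k'] integrated by parts; the boundary term at [s = t] vanishes because
     [chi t t = 0]. *)
  pose D := 2^-1 * (k t * dot (f t) (f t)) - k t * chi t 0 - conv k (dchi t) t.
  pose m := k t * dot (J (u 0)) (W t) + conv k (fun s => dot (W s) (W t)) t.
  (* By [reg_swap], [dot (K (q t)) (W t) = dot (P t) (df t)], which cancels against the derivatives
     of the potential and memory terms, and [dot (K (q t)) (J (y t)) = dot (P t) (P t)]. *)
  have dLE : dL t = - D + eps * (dot (P t) (P t) + m - dot (W t) (W t)).
    rewrite /dL (dotC dot (W t) (K (q t))) (dotC dot (K (q t)) (W t)).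
    rewrite (dotC dot (K (q t)) (J (y t))) !(reg_swap reg) Jq -/(P t) -/(df t).
    rewrite (dotC dot (W t) (J (dy t))) Jdy Kdf.
    have -> : conv k (fun s => dot (df s) (f s) + dot (f s) (df s)) t = 2 * cdff t.
      rewrite -(convZ ck 2 _ (cdot _ _ cdf cf)); congr conv; apply/funext => s.
      by rewrite (dotC dot (f s)); ring.
    have -> : dot (K (zu t)) (df t) = dot (P t) (df t) + dot (f t) (df t).
      by rewrite PE dotBl subrK.
    rewrite /D /m conv_dchi /chi (dotC dot (df t) (P t)) (dotC dot (df t) (f t)).
    by field.
  have diss1 : eta * conv k (chi t) t <= - (k t * chi t 0) - conv k (dchi t) t.
    have := conv_dissipation eta0 ck kac kdecay t0' (c_chi t) (c_dchi t) (chiP t).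
    rewrite chi_tt mulr0 sub0r; apply => s _.
    by rewrite chiE mulr_ge0// sqr_ge0.
  have tail : eta * (1 - kap t) <= k t by exact: kernel_tail.
  have h1 : eta * N2 t <= 2 * D.
    have := ler_wpM2r (dot_ge0 hdot (f t)) tail; rewrite /N2 /D; lra.
  have h3 : m <= 2^-1 * dot (W t) (W t) + k 0 / C * D.
    (* The cross term of the derivative of [dot (W t) (J (y t))] is absorbed by the
       dissipation of [chi2], which is nonnegative by AM-GM and coercivity. *)
    pose a := 2^-1 * (dot (W t) (W t) / k 0) - dot (J (u t)) (W t).
    pose chi2 s := k 0 / C * chi t s + dot (J (u s)) (W t) + a.
    pose dchi2 s := k 0 / C * dchi t s + dot (W s) (W t).
    have c_Uw : continuous (fun s => dot (J (u s)) (W t)) by exact: (cdot _ _ (cJ _ cu) (cst _)).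
    have c_Ww : continuous (fun s => dot (W s) (W t)) by exact: (cdot _ _ cW (cst _)).
    have c2 : continuous chi2.
      exact: (cadd _ _ (cadd _ _ (cmul _ _ (c_chi t)) c_Uw) (cstR a)).
    have dc2 : continuous dchi2 by exact: (cadd _ _ (cmul _ _ (c_dchi t)) c_Ww).
    have chi2P (s : R) : 0 < s -> is_derive s 1 chi2 (dchi2 s).
      move=> s0; have d1 := is_derive_scale (k 0 / C) (chiP t s s0).
      have d2 := w_U.1 (W t) s s0.
      apply: is_derive_eq_val (is_derive_add (is_derive_add d1 d2) (is_derive_cst a s 1)) _.
      by rewrite addr0.
    have chi2_ge0 s : 0 <= chi2 s.
      have hU : k 0 * dot (J (u t) - J (u s)) (J (u t) - J (u s)) <= 2 * (k 0 / C * chi t s).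
        have := reg_coercive reg (u t - u s); rewrite Jsub Ksub hdot => hc.
        have -> : 2 * (k 0 / C * chi t s) = k 0 * (C^-1 * `|f t - f s| ^+ 2).
          by rewrite chiE distrC; field; rewrite gt_eqF.
        by rewrite ler_pM2l// ler_pdivlMl.
      have := amgm (J (u t) - J (u s)) (W t) (k 0) k00.
      by rewrite dotBl /chi2 /a; move: hU; lra.
    have := conv_dissipation eta0 ck kac kdecay t0' c2 dc2 chi2P (fun s _ => chi2_ge0 s).
    have := mulr_ge0 (ltW eta0) (conv_ge0 k_ge0 (fun s (_ : 0 <= s <= t) => chi2_ge0 s)).
    have -> : conv k dchi2 t = k 0 / C * conv k (dchi t) t + conv k (fun s => dot (W s) (W t)) t.
      by rewrite /dchi2 (convD ck _ (cmul _ _ (c_dchi t)) c_Ww) convZ.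
    have chi2_t : chi2 t = dot (J (u t)) (W t) + a by rewrite /chi2 chi_tt mulr0 add0r.
    have -> : k 0 * chi2 t = 2^-1 * dot (W t) (W t).
      by rewrite chi2_t /a; field; rewrite gt_eqF.
    have chi2_0 : chi2 0 = k 0 / C * chi t 0 + dot (J (u 0)) (W t) + a by [].
    (* The constant [a] may be negative; the leftover [- k t * a] is absorbed by the first term of
       [D]. *)
    have a_ge : 0 <= a + 2^-1 * (k 0 / C * dot (f t) (f t)).
      have hU : k 0 * dot (J (u t)) (J (u t)) <= k 0 / C * dot (f t) (f t).
        rewrite -mulrA ler_pM2l// ler_pdivlMl// -!hdot; exact: reg_coercive reg _.
      have := amgm (J (u t)) (W t) (k 0) k00.
      by rewrite /a; move: hU; set z := _ / _; set z' := _ / _; lra.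
    have := mulr_ge0 (k_ge0 t) a_ge.
    rewrite chi2_0 /m /D; move: (conv k chi2 t) (conv k (dchi t) t) (k 0 / C) => x1 x2 kc.
    lra.
  rewrite dLE.
  apply: le_trans (lyapunov_dissipation k00 C0 eta0 (N2_ge0 t t0') h1 (P_le t t0') h3) _.
  have /andP[_ hL] := L_bounds t t0'.
  have a0 : 0 < (2 * decay_time (k 0) C eta)^-1 by rewrite invr_gt0 mulr_gt0.
  have := ler_wpM2l (ltW a0) hL.
  have -> : (2 * decay_time (k 0) C eta)^-1 * (4 / 3 * E t) =
     2 / (3 * decay_time (k 0) C eta) * (2^-1 * (dot (W t) (W t) + N2 t)).
    by rewrite /E; field; lra.
  by lra.
have Lc0 : {for (0 : R), continuous L}.
  have z0 : zu 0 = 0 by apply: (dot_eq hdot) => w; rewrite zuE dot0l /conv integral_segment0.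
  have zc : zu t @[t --> (0 : R)] --> zu 0 by rewrite z0.
  have yc : y t @[t --> (0 : R)] --> y 0 by apply: cvgB => //; exact: cu.
  (* [K] is moved onto the continuous factor, because the convergence at 0 at hand is that of
     [zu]. *)
  have c1 : dot (K (zu t)) (f t) @[t --> (0 : R)] --> dot (K (zu 0)) (f 0).
    rewrite (reg_op_sym reg); under eq_fun do rewrite (reg_op_sym reg).
    by apply: (cvg_dot hdot zc); exact: (cK _ cf 0).
  have c2 : dot (W t) (J (y t)) @[t --> (0 : R)] --> dot (W 0) (J (y 0)).
    rewrite -(reg_sym reg); under eq_fun do rewrite -(reg_sym reg).
    by apply: (cvg_dot hdot) yc; exact: (cJ _ cW 0).
  have c3 : cff t @[t --> (0 : R)] --> cff 0.
    have -> : cff 0 = 0 by rewrite /cff /conv integral_segment0.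
    exact: conv_cvg0.
  apply: cvgD; last by apply: cvgM; [exact: cvg_cst|exact: c2].
  apply: cvgB; last exact: c1.
  apply: cvgM; first exact: cvg_cst.
  apply: cvgD; last exact: c3.
  by apply: cvgD; [exact: (cdot _ _ cW cW 0)|exact: (c_ff 0)].
have := @gronwall_decay R L dL (2 * decay_time (k 0) C eta)^-1 T T0.
move=> /(_ (fun x hx => LP x (andP hx).1) (fun x hx => dL_le x (andP hx).1)).
have Lc (x : R) : 0 <= x <= T -> {for x, continuous L}.
  move=> /andP[x0 _]; have [->//|xn] := eqVneq x 0.
  by apply: is_derive_cts (LP x _); rewrite lt_neqAle eq_sym xn.
move=> /(_ Lc) hL; rewrite !energyE//.
have /andP[l1 _] := L_bounds T T0; have /andP[_ l2] := L_bounds 0 (lexx 0).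
have := ler_wpM2r (expR_ge0 (- ((2 * decay_time (k 0) C eta)^-1 * T))) l2.
move: hL l1; set x := expR _; lra.
Qed.

End RegularizedEnergy.

(** * Weak solutions *)

Section HalfLineCalculus.
Context {R : realType}.

Lemma halfline_quotient_near (W : normedModType R) (f : R -> W) (t : R) (e : R) :
  derivable_halfline f t -> 0 < e ->
  \forall s \near t, 0 <= s ->
    `|f s - f t - (s - t) *: derive_halfline f t| <= e * `|s - t|.
Proof.
move=> df e0; have /cvgrPdist_le/(_ _ e0) : quotient_halfline f t --> derive_halfline f t by [].
move=> /nbhs_ballP[r /= r0 hr]; apply/nbhs_ballP; exists r => //= s st s0.
have [->|sNt] := eqVneq s t; first by rewrite !subrr scale0r subrr !normr0 mulr0.
have st0 : s - t != 0 by rewrite subr_eq0.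
have := hr s st sNt s0 => /= h.
have -> : f s - f t - (s - t) *: derive_halfline f t =
    - ((s - t) *: (derive_halfline f t - (s - t)^-1 *: (f s - f t))).
  by rewrite scalerBr scalerA divff// scale1r opprB.
by rewrite normrN normrZ mulrC ler_wpM2r.
Qed.

Lemma derivable_halfline_cvg (W : normedModType R) (f : R -> W) (t : R) :
  derivable_halfline f t -> f s @[s --> within [set s | 0 <= s] (nbhs t)] --> f t.
Proof.
move=> df; apply/cvgrPdist_le => e e0; rewrite near_withinE.
pose M := `|derive_halfline f t| + 1.
have M0 : 0 < M by rewrite ltr_wpDl.
have hn := halfline_quotient_near df (@ltr01 R).
near=> s => s0.
have : 0 <= s -> `|f s - f t - (s - t) *: derive_halfline f t| <= 1 * `|s - t|.
  by near: s; exact: hn.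
move=> /(_ s0).
have hd := ler_normD (f s - f t - (s - t) *: derive_halfline f t) ((s - t) *: derive_halfline f t).
rewrite subrK normrZ in hd.
have : `|t - s| < e / M.
  by near: s; apply/nbhs_ballP; exists (e / M) => /=; [rewrite divr_gt0|move=> s;
    rewrite -ball_normE].
rewrite ltr_pdivlMr// distrC (distrC (f t)) /M => h1 h2; lra.
Unshelve. all: by end_near. Qed.

Lemma is_derive_halfline (f : R -> R^o) (t : R) : 0 < t -> derivable_halfline f t ->
  is_derive t 1 (f : R -> R) (derive_halfline f t).
Proof.
move=> t0 df; apply/is_derive_near => e e0.
have hn := halfline_quotient_near df e0.
near=> s.
have s0 : 0 <= s by apply/ltW; near: s; exact: near_gt.
have : 0 <= s -> `|f s - f t - (s - t) *: derive_halfline f t| <= e * `|s - t|.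
  by near: s; exact: hn.
by move=> /(_ s0); rewrite [_ *: _]mulrC.
Unshelve. all: by end_near. Qed.

Lemma continuous_halfline_extension (W : normedModType R) (f : R -> W) :
  (forall t : R, 0 <= t -> f s @[s --> within [set s | 0 <= s] (nbhs t)] --> f t) ->
  continuous (fun t : R => f (Num.max t 0)).
Proof.
move=> hf t.
have m0 (x : R) : 0 <= Num.max x 0 by rewrite le_max lexx orbT.
apply/cvgrPdist_lt => e e0.
have := hf _ (m0 t) => /cvgrPdist_lt/(_ _ e0); rewrite near_withinE => h.
have cm : Num.max s 0 @[s --> t] --> Num.max t 0.
  apply: (@continuous_max R R id (fun=> 0)); last exact: cst_continuous.
  exact: cvg_id.
have hh : \forall s \near t, 0 <= Num.max s 0 -> `|f (Num.max t 0) - f (Num.max s 0)| < e := cm _ h.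
by apply: filterS hh => s; apply; exact: m0.
Qed.

End HalfLineCalculus.

(** * Removal of the regularization *)

Section Main.
Context {R : realType} {H : completeNormedModType R}.
Notation mu := (@lebesgue_measure R).
Variables (dot : {dot H for @idfun R}) (B : linear_operator H) (C : R).
Hypothesis hdot : hilbert_norm dot.

(** Since [K n (u s) = J n (b s)], every term reduces to [J n x --> x]. In the memory term,
    contractivity makes the limit integrand itself a dominating function. *)
Lemma regularized_energy_cvg (J K : nat -> H -> H) (k : R -> R) (u v b : R -> H) (t : R) :
  (forall n, regularizer dot B C (J n) (K n)) -> (forall x, J n x @[n --> \oo] --> x) ->
  continuous k -> (forall t, 0 <= k t) -> continuous b ->
  (forall t, op_dom B (u t) /\ b t = B (u t)) -> 0 <= t ->
  regularized_energy (J n) (K n) k u v t @[n --> \oo] -->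
  2^-1 * `|v t| ^+ 2 + 2^-1 * (1 - \int[mu]_(s in `[0, t]) k s) * `|b t| ^+ 2
    + 2^-1 * conv k (fun s => `|b s - b t| ^+ 2) t.
Proof.
move=> reg Jc ck k0 cb bE t0.
have KE n s : K n (u s) = J n (b s).
  by have [uD ->] := bE s; rewrite (reg_comm (reg n) uD).
have sq (c : nat -> H) l : c @ \oo --> l -> `|c n| ^+ 2 @[n --> \oo] --> `|l| ^+ 2.
  move=> cc; rewrite expr2; under eq_fun do rewrite expr2.
  by apply: cvgM; exact: cvg_norm.
have csq (g : R -> H) : continuous g -> continuous (fun s : R => k (t - s) * `|g s| ^+ 2).
  move=> cg; apply: continuousM_fun; first exact: continuous_comp_sub.
  by under eq_fun do rewrite hdot; exact: continuous_dot.
have cbt : continuous (fun s : R => b s - b t).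
  by move=> s; apply: cvgB; [exact: cb|exact: cvg_cst].
have cJ n : continuous (fun s : R => J n (b s - b t)).
  apply: (@continuous_bounded_operator _ _ (J n) 1) cbt => [x y|x].
    exact: (sym_subr hdot (reg_sym (reg n))).
  by rewrite mul1r; exact: reg_contr (reg n) x.
have memory : conv k (fun s => `|J n (b s - b t)| ^+ 2) t @[n --> \oo] -->
    conv k (fun s => `|b s - b t| ^+ 2) t.
  have fin (g : R -> H) : continuous g ->
     (\int[mu]_(s in `[0%R, t]) (k (t - s) * `|g s| ^+ 2)%:E)%E =
     (conv k (fun s => `|g s| ^+ 2) t)%:E.
    move=> cg; rewrite /conv /Rintegral fineK//.
    by apply: integrable_fin_num => //; exact: continuous_integrable _ _ (csq g cg).
  have dct := @dominated_cvg _ _ R mu `[0, t]%classic (measurable_itv _)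
    (fun n s => (k (t - s) * `|J n (b s - b t)| ^+ 2)%:E)
    (fun s => (k (t - s) * `|b s - b t| ^+ 2)%:E)
    (fun s => (k (t - s) * `|b s - b t| ^+ 2)%:E).
  have hc : (fun n => (conv k (fun s => `|J n (b s - b t)| ^+ 2) t)%:E) @ \oo -->
      (conv k (fun s => `|b s - b t| ^+ 2) t)%:E.
    rewrite -(fin _ cbt).
    have -> : (fun n => (conv k (fun s => `|J n (b s - b t)| ^+ 2) t)%:E) =
        (fun n => (\int[mu]_(s in `[0%R, t]) (k (t - s) * `|J n (b s - b t)| ^+ 2)%:E)%E).
      by apply/funext => n; rewrite (fin _ (cJ n)).
    apply: dct => //.
    - move=> n; apply/measurable_EFinP; apply: measurable_funTS.
      by apply: continuous_measurable_fun; exact: csq.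
    - move=> s _; apply: cvg_EFin; first exact: nearW.
      by apply: cvgM; [exact: cvg_cst|apply: sq; exact: Jc].
    - exact: continuous_integrable _ _ (csq _ cbt).
    - move=> n s _; rewrite lee_fin ger0_norm ?mulr_ge0// ?sqr_ge0//.
      by rewrite ler_wpM2l// ler_pXn2r ?nnegrE//; exact: reg_contr (reg n) _.
  exact: (fine_cvg hc).
rewrite /regularized_energy.
apply: cvgD; last first.
  apply: cvgM; first exact: cvg_cst.
  have -> : (fun n => conv k (fun s => `|K n (u s) - K n (u t)| ^+ 2) t) =
      (fun n => conv k (fun s => `|J n (b s - b t)| ^+ 2) t).
    apply/funext => n; congr conv; apply/funext => s.
    by rewrite !KE -(sym_subr hdot (reg_sym (reg n))).
  exact: memory.
apply: cvgD; first by apply: cvgM; [exact: cvg_cst|exact: sq].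
apply: cvgM; first exact: cvg_cst.
by apply: sq; under eq_fun do rewrite KE; exact: Jc.
Qed.

End Main.

Lemma expR1_ge2 (R : realType) : 2 <= expR (1 : R).
Proof. by have := expR_ge1Dx (1 : R); rewrite -[1 + 1]/(2 : R). Qed.

Unset Implicit Arguments.

Theorem theorem3p1 (R : realType) (H : completeNormedModType R)
    (dot : {dot H for @idfun R}) (hdot : hilbert_norm dot)
    (A : linear_operator H) (hA : self_adjoint dot A)
    (C : R) (hC : 0 < C)
    (hcoer : forall x : H, op_dom A x -> C * `|x| ^+ 2 <= dot (A x) x)
    (sqrtA : linear_operator H) (hsqrtA : is_sqrt_operator dot A sqrtA)
    (k : R -> R) (hk : forall t : R, 0 <= t -> 0 <= k t)
    (hkac : locally_absolutely_continuous k)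
    (hk0 : 0 < k 0)
    (hkint : (\int[@lebesgue_measure R]_(t in `[0%R, +oo[) (k t)%:E = 1)%E)
    (eta : R) (heta : 0 < eta)
    (hkdecay : {ae @lebesgue_measure R, forall t : R, 0 <= t ->
       derivable k t 1 /\ derive1 k t <= - eta * k t})
    (u : R -> H) (hu : weak_solution dot k sqrtA u) :
  let alpha := (2 * ((k 0 + 2) / C + 1 + 3 / eta))^-1 in
  forall t : R, 0 <= t ->
    energy k sqrtA u t <= energy k sqrtA u 0 * expR (1 - alpha * t).
Proof.
have [hB pB sqB] := hsqrtA; have [[uD Bucts] [du vcts] hweak] := hu.
have [J [K [reg Jc]]] := regularizers hdot hB pB sqB hcoer.
have m0 (x : R) : 0 <= Num.max x 0 by rewrite le_max lexx orbT.
have mE (x : R) : 0 <= x -> Num.max x 0 = x by move=> x0; rewrite max_l.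
(* Continuous extensions to [R] of functions that only matter on [0, +oo[. *)
pose kk x := k (Num.max x 0); pose uu x := u (Num.max x 0).
pose vv x := derive_halfline u (Num.max x 0); pose bb x := sqrtA (u (Num.max x 0)).
have kkE (x : R) : 0 <= x -> kk x = k x by move=> x0; rewrite /kk mE.
have ckk : continuous kk by exact: locally_absolutely_continuous_continuous.
have kk_ge0 x : 0 <= kk x by exact: hk.
have cuu : continuous uu.
  by apply: continuous_halfline_extension => t t0; exact: derivable_halfline_cvg (du t t0).
have cvv : continuous vv.
  apply: continuous_halfline_extension => t t0.
  have -> : [set s : R | 0 <= s] = `[0, +oo[%classic.
    by apply/seteqP; split => x /=; rewrite in_itv /= andbT.
  by move/subspace_continuousP : vcts; apply; rewrite /= in_itv /= andbT.
have cbb : continuous bb.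
  apply: (@continuous_halfline_extension R H (fun t => sqrtA (u t))) => t t0.
  apply/cvgrPdist_lt => e e0.
  have := Bucts t t0 => /cvgrPdist_lt/(_ _ e0); rewrite !near_withinE.
  apply: filterS => s hs s0; have := hs s0.
  by rewrite sub0r normrN normr_id op_funB 1?distrC//; exact: uD.
have bbE t : op_dom sqrtA (uu t) /\ bb t = sqrtA (uu t) by split => //; exact: uD.
have near_pos (t : R) : 0 < t -> \forall s \near t, Num.max s 0 = s.
  by move=> t0; near=> s; apply: mE; apply/ltW; near: s; exact: near_gt.
have kkac : locally_absolutely_continuous kk.
  move=> T T0; apply: (@absolutely_continuous_on_majorant R k kk 0 T 1) (hkac T T0) => //.
  move=> p q p0 pq qT; rewrite !kkE//; last exact: le_trans pq.
  by rewrite mul1r lerDl subr_ge0.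
(* Restricted to [x > 0], where [kk] agrees with [k] on a neighbourhood; at 0 the extension may have
   a corner. *)
have kkdecay : {ae @lebesgue_measure R, forall x : R, 0 < x ->
    derivable kk x 1 /\ derive1 kk x <= - eta * kk x}.
  have [N [mN N0 HN]] := hkdecay.
  exists N; split => // x hnx; apply: HN => hx; apply: hnx => x0.
  have [kx kxe] := hx (ltW x0).
  have dk : is_derive x 1 k (derive1 k x) by split => //; rewrite derive1E.
  have [dkk vkk] : is_derive x 1 kk (derive1 k x).
    apply: is_derive_near_eq dk _; apply: filterS (near_pos x x0) => s hs.
    by rewrite /kk hs.
  by split => //; rewrite derive1E vkk kkE// ltW.
have kkint : (\int[@lebesgue_measure R]_(t in `[0%R, +oo[) (kk t)%:E = 1)%E.
  rewrite -hkint; apply: eq_integral => x; rewrite inE /= in_itv /= andbT => x0.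
  by rewrite kkE.
have kk0 : kk 0 = k 0 by rewrite kkE.
have uv : weakly_C1 dot uu vv.
  split.
    move=> w t t0; rewrite /vv mE ?ltW//.
    apply: (@is_derive_near_eq R (fun s => dot (u s) w)); last first.
      by apply: filterS (near_pos t t0) => s hs; rewrite /uu hs.
    apply/is_derive_near => e e0.
    have w1 : 0 < `|w| + 1 by rewrite ltr_wpDl.
    have e1 : 0 < e / (`|w| + 1) by rewrite divr_gt0.
    have := halfline_quotient_near (du t (ltW t0)) e1.
    have := near_gt t0; apply: filterS2 => s s0 /(_ (ltW s0)) hs.
    have -> : dot (u s) w - dot (u t) w - dot (derive_halfline u t) w * (s - t) =
        dot (u s - u t - (s - t) *: derive_halfline u t) w.
      by rewrite !dotBl dotZl; ring.
    apply: le_trans (dot_le_norm hdot _ _) _.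
    apply: (@le_trans _ _ (e / (`|w| + 1) * `|s - t| * (`|w| + 1))).
      by apply: ler_pM => //; rewrite lerDl.
    by rewrite mulrAC divfK// gt_eqF.
  move=> T; have [M _ hM] := norm_bounded_on_segment T cvv.
  by exists M => s /andP[s0 sT]; apply: hM; rewrite !ltW.
have convE_kk (f g : R -> R) t : 0 <= t -> (forall s, 0 <= s -> f s = g s) ->
    conv kk f t = \int[@lebesgue_measure R]_(s in `[0, t]) (k (t - s) * g s).
  move=> t0 fg; apply: eq_Rintegral => s; rewrite inE /= in_itv /= => /andP[s0 st].
  by rewrite fg// kkE// subr_ge0.
have eqn w : op_dom sqrtA w -> forall t : R, 0 < t ->
    is_derive t 1 (fun s => dot (vv s) w)
      (conv kk (fun s => dot (bb s) (sqrtA w)) t - dot (bb t) (sqrtA w)).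
  move=> wD t t0; have /= [[dw _] eq_w] := hweak w wD.
  apply: (@is_derive_near_eq R (fun s => dot (derive_halfline u s) w)); last first.
    by apply: filterS (near_pos t t0) => s hs; rewrite /vv hs.
  apply: is_derive_eq_val (is_derive_halfline t0 (dw t (ltW t0))) _.
  have := eq_w t (ltW t0).
  rewrite (convE_kk _ (fun s => dot (sqrtA (u s)) (sqrtA w)) t (ltW t0)); last first.
    by move=> s s0; rewrite /bb mE.
  by rewrite /bb mE ?ltW//; set x := derive_halfline _ _; lra.
have energyE t : 0 <= t -> energy k sqrtA u t =
    2^-1 * `|vv t| ^+ 2 + 2^-1 * (1 - \int[@lebesgue_measure R]_(s in `[0, t]) kk s) * `|bb t| ^+ 2
    + 2^-1 * conv kk (fun s => `|bb s - bb t| ^+ 2) t.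
  move=> t0; rewrite /energy /vv /bb mE//; congr (_ + _ * _ * _ + _ * _).
    congr (1 - _); apply: eq_Rintegral => s; rewrite inE /= in_itv /= => /andP[s0 _].
    by rewrite kkE.
  by rewrite (convE_kk _ (fun s => `|sqrtA (u s) - sqrtA (u t)| ^+ 2) t t0)// => s s0; rewrite mE.
move=> alpha t t0.
have energy0 : energy k sqrtA u 0 = 2^-1 * `|vv 0| ^+ 2 + 2^-1 * `|bb 0| ^+ 2.
  by rewrite energyE// /conv !(integral_segment0 _ (lexx 0)) mulr0 addr0 subr0 mulr1.
have energy0_ge0 : 0 <= energy k sqrtA u 0.
  by rewrite energy0 addr_ge0// mulr_ge0// sqr_ge0.
(* At time 0 the memory term is empty and contractivity gives a bound uniform in [n], so only the
   energy at time [t] has to pass to the limit. *)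
have reg_energy0 n : regularized_energy (J n) (K n) kk uu vv 0 <= energy k sqrtA u 0.
  rewrite energy0 /regularized_energy /conv !(integral_segment0 _ (lexx 0)) mulr0 addr0 subr0 mulr1.
  have [uuD bb0] := bbE 0; rewrite (reg_comm (reg n) uuD) -bb0.
  by apply: lerD; rewrite ler_wpM2l// ler_pXn2r ?nnegrE//; exact: reg_contr (reg n) _.
have decay n : regularized_energy (J n) (K n) kk uu vv t <=
    2 * energy k sqrtA u 0 * expR (- (alpha * t)).
  have kk00 : 0 < kk 0 by rewrite kk0.
  have := regularized_energy_decay hdot (reg n) hC heta ckk kkac kkdecay kk_ge0 kk00 kkint
    cuu cvv cbb bbE uv eqn t0.
  rewrite kk0 => h; apply: le_trans h _.
  by rewrite ler_wpM2r ?expR_ge0// ler_pM2l.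
have lim : energy k sqrtA u t <= 2 * energy k sqrtA u 0 * expR (- (alpha * t)).
  have hc := regularized_energy_cvg hdot reg Jc ckk kk_ge0 cbb bbE t0 (v := vv).
  rewrite -energyE// in hc.
  have hd : (fun _ : nat => 2 * energy k sqrtA u 0 * expR (- (alpha * t))) @ \oo -->
      2 * energy k sqrtA u 0 * expR (- (alpha * t)) by exact: cvg_cst.
  by apply: (ler_cvg_to hc hd); exact: nearW.
apply: le_trans lim _.
rewrite expRD mulrA [2 * _]mulrC ler_wpM2r ?expR_ge0// ler_wpM2l//.
exact: expR1_ge2.
Unshelve. all: by end_near. Qed.
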